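(* Let $k$ be an algebraically closed field of characteristic $p>2$, and let $C$ be a smooth proper genus $2$ curve over $k$ given on an affine open set by $y^2=g(x)=x^5+a_1x^4+a_2x^3+a_3x^2+a_4x+a_5$. Let $g_p(x)=\theta^{p-1}(x)$, where $\theta$ is the derivation $\theta f=y\frac{df}{dx}$, and denote by $h_1,h_2,h_3,h_4$ the polynomials in the coefficients of $g(x)$ giving respectively the constant coefficient, the coefficient of $x$, the coefficient of $x^p$, and the coefficient of $x^{p+1}$ of $g_p(x)$. Then the $p$-rank of the Jacobian of $C$ is: - $2$ if $h_1h_4-h_2h_3\neq 0$; - $1$ if $h_1h_4-h_2h_3=0$ but either $h_3^p-h_2h_4^{p-1}\neq 0$ or $h_1^ph_4-h_2^{p+1}\neq 0$; - $0$ if $h_1h_4-h_2h_3=h_3^p-h_2h_4^{p-1}=h_1^ph_4-h_2^{p+1}=0$.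
   Context: The complement of the affine open set $\{y^2=g(x)\}$ in $C$ is a single smooth Weierstrass point at infinity. For the derivation $\theta$ one has $\theta(x)=y$ and $\theta(y)=\tfrac12 g'(x)$. For odd $m$, $g_m(x):=\theta^{m-1}(x)$ is a polynomial in $x$, given by $g_1(x)=x$ and $g_m(x)=g_{m-2}''(x)g(x)+\tfrac12 g_{m-2}'(x)g'(x)$; in characteristic $p$, the only terms of $g_p(x)$ that can be nonzero are those in degrees $0$, $1$, $p$, $p+1$. The $p$-rank of the Jacobian $J$ is the integer $r$ with $\#J[p](k)=p^r$. *)

(* Defs.v *)
From HB Require Import structures.
From mathcomp Require Import all_boot all_algebra.
From mathcomp Require Import ring_quotient generic_quotient fraction polyXY.
From mathcomp Require Import qpoly qfpoly.
From mathcomp Require Import freeg.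
From mathcomp Require Import boolp classical_sets functions cardinality.
From mathcomp Require Import ring.

Set Implicit Arguments.
Unset Strict Implicit.
Unset Printing Implicit Defensive.

Import GRing.Theory.
Local Open Scope ring_scope.

Section RationalFunctions.
Variable k : fieldType.
Local Notation F := {fraction {poly k}}.
Implicit Types (r s : F) (q n d : {poly k}).

Definition frac_deriv r : F :=
  let n := \n_(repr r) in let d := \d_(repr r) in
  tofrac (n^`() * d - n * d^`()) / tofrac (d ^+ 2).

Lemma fracE r : r = tofrac \n_(repr r) / tofrac \d_(repr r).
Proof.
have d0 : tofrac \d_(repr r) != 0 by rewrite tofrac_eq0 denom_ratioP.
apply: (mulIf d0); rewrite mulfVK //.
have rE := reprK r; set x := repr r in rE d0 *; rewrite -{}rE.
unlock FracField.tofrac; rewrite -[LHS]FracField.pi_mul; apply/eqmodP => /=.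
rewrite FracField.equivfE /FracField.mulf.
by rewrite !numden_Ratio ?mulr1 ?oner_neq0 ?denom_ratioP // mulrC.
Qed.

Lemma frac_derivE n d : d != 0 ->
  frac_deriv (tofrac n / tofrac d) =
    tofrac (n^`() * d - n * d^`()) / tofrac (d ^+ 2).
Proof.
move=> d0; set r := tofrac n / tofrac d; rewrite /frac_deriv.
set N := \n_(repr r); set D := \d_(repr r).
have D0 : D != 0 by exact: denom_ratioP.
have /eqP : r = tofrac N / tofrac D by exact: fracE.
rewrite /r eqr_div ?tofrac_eq0 // -!tofracM tofrac_eq => /eqP e.
have e' : n^`() * D + n * D^`() = N^`() * d + N * d^`() by rewrite -!derivM e.
apply/eqP; rewrite eqr_div ?tofrac_eq0 ?expf_neq0 // -!tofracM tofrac_eq.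
apply/eqP; symmetry.
have -> : (n^`() * d - n * d^`()) * D ^+ 2
  = (n^`() * D + n * D^`()) * (d * D) - (n * D) * (D^`() * d + d^`() * D) by ring.
by rewrite e' e; ring.
Qed.

Lemma frac_deriv_tofrac q : frac_deriv (tofrac q) = tofrac q^`().
Proof.
rewrite -[tofrac q]divr1 -tofrac1 frac_derivE ?oner_neq0 //.
by rewrite derivC mulr0 mulr1 subr0 expr1n tofrac1 divr1.
Qed.

Lemma fracP r : exists2 nd : {poly k} * {poly k},
  nd.2 != 0 & r = tofrac nd.1 / tofrac nd.2.
Proof. by exists (frac (repr r)); [exact: denom_ratioP | exact: fracE]. Qed.

Lemma frac_derivD r s : frac_deriv (r + s) = frac_deriv r + frac_deriv s.
Proof.
have [[n d] /= d0 ->] := fracP r; have [[m e] /= e0 ->] := fracP s.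
have tr : tofrac d != 0 by rewrite tofrac_eq0.
have ts : tofrac e != 0 by rewrite tofrac_eq0.
rewrite (addf_div _ _ tr ts) -!tofracM -tofracD !frac_derivE ?mulf_neq0 //.
rewrite addf_div ?tofrac_eq0 ?expf_neq0 // -!tofracM -tofracD; apply/eqP.
rewrite eqr_div ?tofrac_eq0 ?(mulf_neq0, expf_neq0) //.
by rewrite -!tofracM tofrac_eq; apply/eqP; rewrite !(derivD, derivM); ring.
Qed.

Lemma frac_derivM r s :
  frac_deriv (r * s) = frac_deriv r * s + r * frac_deriv s.
Proof.
have [[n d] /= d0 ->] := fracP r; have [[m e] /= e0 ->] := fracP s.
rewrite mulf_div -!tofracM !frac_derivE ?mulf_neq0 // !mulf_div -!tofracM.
rewrite addf_div ?tofrac_eq0 ?(mulf_neq0, expf_neq0) //.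
rewrite -!tofracM -tofracD; apply/eqP.
rewrite eqr_div ?tofrac_eq0 ?(mulf_neq0, expf_neq0) //.
by rewrite -!tofracM tofrac_eq; apply/eqP; rewrite !derivM; ring.
Qed.

End RationalFunctions.

(* The coefficients of g = 'X^5 + a_1 'X^4 + a_2 'X^3 + a_3 'X^2 + a_4 'X + a_5. *)
Record quintic (k : fieldType) := Quintic { a_1 : k; a_2 : k; a_3 : k; a_4 : k; a_5 : k }.

Definition quintic_poly (k : fieldType) (g : quintic k) : {poly k} :=
  'X^5 + (a_1 g *: 'X^4 + a_2 g *: 'X^3 + a_3 g *: 'X^2 + a_4 g *: 'X + (a_5 g)%:P).
Coercion quintic_poly : quintic >-> polynomial.

Section Irreducible.
Variables (k : fieldType) (g : quintic k).
Local Notation F := {fraction {poly k}}.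

Lemma size_quintic : size g = 6.
Proof.
rewrite size_polyDl size_polyXn // ltnS.
do 4?[apply: (leq_trans (size_polyD _ _)); rewrite geq_max; apply/andP; split];
  try by apply: (leq_trans (size_scale_leq _ _)); rewrite ?size_polyXn ?size_polyX.
by apply: (leq_trans (size_polyC_leq1 _)).
Qed.

Definition weierstrass_poly : {poly F} := 'X^2 - (tofrac (g : {poly k}))%:P.

Lemma size_weierstrass : size weierstrass_poly = 3.
Proof.
rewrite size_polyDl size_polyXn // size_polyN.
by apply: (leq_ltn_trans (size_polyC_leq1 _)).
Qed.

Lemma weierstrass_monic_irreducible : monic_irreducible_poly weierstrass_poly.
Proof.
split.
  apply: cubic_irreducible; rewrite ?size_weierstrass // => z.
  apply/negP => /rootP; rewrite /weierstrass_poly !hornerE (fracE z).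
  have := denom_ratioP (repr z); set n := \n_(_); set d := \d_(_) => d0.
  have g0 : (g : {poly k}) != 0 by rewrite -size_poly_eq0 size_quintic.
  move/eqP; rewrite subr_eq0 expr_div_n -!tofracXn -[X in _ == X]divr1 -tofrac1.
  rewrite eqr_div ?tofrac_eq0 ?oner_neq0 ?expf_neq0 // -!tofracM tofrac_eq.
  rewrite mulr1 => /eqP e.
  have n0 : n != 0.
    apply/eqP => n0; move/eqP: e; rewrite n0 expr0n /= eq_sym mulf_eq0.
    by rewrite (negPf g0) expf_eq0 (negPf d0).
  have := congr1 (fun q : {poly k} => odd (size q)) e.
  rewrite !expr2 !size_mul ?mulf_neq0 // size_quintic.
  move: n0 d0; rewrite -!size_poly_gt0.
  case: (size n) => // a; case: (size d) => // b _ _.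
  by rewrite !addnS /= !oddD; case: (odd a); case: (odd b).
rewrite monicE lead_coefDl ?lead_coefXn // size_polyXn size_polyN.
by apply: (leq_ltn_trans (size_polyC_leq1 _)).
Qed.

End Irreducible.

Section Identities.
Variables (F K : fieldType) (j : {rmorphism F -> K}).
Implicit Types (a b c d u w : F) (y : K).

Lemma ddxD_aux b d a' b' c' d' u y :
  j (a' + c') + j (b' + d' + (b + d) * u) * y =
  j a' + j (b' + b * u) * y + (j c' + j (d' + d * u) * y).
Proof. by rewrite !(rmorphD, rmorphM) /=; ring. Qed.

Lemma mulK_aux a b c d w y : y ^+ 2 = j w ->
  (j a + j b * y) * (j c + j d * y) =
  j (a * c + b * d * w) + j (a * d + b * c) * y.
Proof. by move=> yE; rewrite !(rmorphD, rmorphM) /= -yE; ring. Qed.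

Lemma ddxM_aux a b c d a' b' c' d' u w y : y ^+ 2 = j w ->
  j (a' * c + a * c' + ((b' * d + b * d') * w + b * d * (u * w *+ 2)))
  + j (a' * d + a * d' + (b' * c + b * c') + (a * d + b * c) * u) * y =
  (j a' + j (b' + b * u) * y) * (j c + j d * y)
  + (j a + j b * y) * (j c' + j (d' + d * u) * y).
Proof. by move=> yE; rewrite mulr2n !(rmorphD, rmorphM) /= -yE; ring. Qed.

Lemma div_aux (f h u w u' w' t t' : K) : h != 0 -> t' != 0 ->
  f * w = t * u -> h * w' = t' * u' -> f / h * (w * u') = t / t' * (u * w').
Proof.
move=> h0 t0 e e'; have -> : u' = h * w' / t' by rewrite e' mulrC mulKf.
transitivity (f * w * w' / t'); first by field; rewrite h0 t0.
by rewrite e; field.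
Qed.
End Identities.

Section Curve.
Variables (k : fieldType) (g : quintic k).
Local Notation F := {fraction {poly k}}.

(* The function field of C : k(x)[Y] / (Y^2 - g). *)
Definition function_field : fieldType :=
  {poly %/ weierstrass_poly g with weierstrass_monic_irreducible g}.
Local Notation K := function_field.
Local Notation G := (quintic_poly g).

Definition fracK (r : F) : K := r%:A.
Definition polyK (q : {poly k}) : K := fracK (tofrac q).
Definition constK (c : k) : K := polyK c%:P.
Definition xK : K := polyK 'X.
Definition yK : K := in_qpoly (weierstrass_poly g) 'X.

(* The two coordinates of f in the basis (1, y) of K over k(x). *)
Definition Kcoord (f : K) (i : nat) : F := (val (f : {poly %/ weierstrass_poly g}))`_i.

(* d/dx on K, determined by dy/dx = g'(x) / (2 y) = (g'(x) / (2 g(x))) y. *)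
Definition ddx (f : K) : K :=
  fracK (frac_deriv (Kcoord f 0)) +
  fracK (frac_deriv (Kcoord f 1) + Kcoord f 1 * (tofrac G^`() / tofrac (G *+ 2)))
    * yK.

Definition theta (f : K) : K := yK * ddx f.

Lemma fracK_is_zmod_morphism : zmod_morphism fracK.
Proof. by move=> p q; rewrite /fracK scalerBl. Qed.
HB.instance Definition _ :=
  GRing.isZmodMorphism.Build _ _ fracK fracK_is_zmod_morphism.
Lemma fracK_is_monoid_morphism : monoid_morphism fracK.
Proof.
split=> [|p q]; rewrite /fracK ?scale1r //.
by rewrite -scalerAl mul1r scalerA.
Qed.
HB.instance Definition _ :=
  GRing.isMonoidMorphism.Build _ _ fracK fracK_is_monoid_morphism.
HB.instance Definition _ := GRing.RMorphism.copy polyK (fracK \o @tofrac _).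
HB.instance Definition _ := GRing.RMorphism.copy constK (polyK \o @polyC k).

Let mkE : mk_monic (weierstrass_poly g) = weierstrass_poly g.
Proof. exact/mk_monicE/weierstrass_monic_irreducible. Qed.

Let rmodX : Pdiv.CommonRing.rmodp 'X (mk_monic (weierstrass_poly g)) = 'X.
Proof.
rewrite mkE Pdiv.CommonRing.rmodp_small // size_polyX.
by rewrite size_weierstrass.
Qed.

Lemma KcoordE a b (f := fracK a + fracK b * yK) : Kcoord f 0 = a /\ Kcoord f 1 = b.
Proof.
have -> : f = a *: 1 + b *: yK by rewrite /f /fracK -scalerAl mul1r.
rewrite /Kcoord /= rmodX !(coefD, coefZ, coefC, coefX) /=.
by rewrite !mulr1 !mulr0 addr0 add0r.
Qed.

Lemma Kbasis (f : K) : f = fracK (Kcoord f 0) + fracK (Kcoord f 1) * yK.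
Proof.
transitivity (Kcoord f 0 *: (1 : K) + Kcoord f 1 *: yK); last first.
  by rewrite /fracK -scalerAl mul1r.
apply: val_inj; rewrite /= rmodX; apply/polyP => i; rewrite /Kcoord.
rewrite !(coefD, coefZ, coefC, coefX).
case: i => [|[|i]] /=; rewrite ?(mulr1, mulr0, addr0, add0r) //.
apply: nth_default.
have sz : size (mk_monic (weierstrass_poly g)) = 3 by rewrite mkE size_weierstrass.
have := size_mk_monic (f : {poly %/ weierstrass_poly g}).
by move=> lt_sz; rewrite -ltnS; apply: leq_trans lt_sz _; rewrite sz.
Qed.

Lemma yK_sqr : yK ^+ 2 = polyK G.
Proof.
apply/eqP; rewrite -subr_eq0; apply/eqP.
have -> : yK ^+ 2 - polyK G = in_qpoly (weierstrass_poly g) (weierstrass_poly g).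
  rewrite /weierstrass_poly -/(weierstrass_poly g) in_qpolyD rmorphN.
  rewrite expr2 in_qpolyM -expr2 /polyK /yK; congr (_ - _).
  transitivity (in_qpoly (weierstrass_poly g) (tofrac G *: 1)).
    by rewrite in_qpolyZ in_qpoly1.
  by congr in_qpoly; rewrite alg_polyC.
by apply: val_inj; rewrite /= mkE Pdiv.RingMonic.rmodpp //;
  case: (weierstrass_monic_irreducible g).
Qed.

Lemma yK_neq0 : yK != 0.
Proof.
apply/eqP => y0; have := yK_sqr; rewrite y0 expr0n /=.
move/esym/eqP; rewrite fmorph_eq0 tofrac_eq0 -size_poly_eq0.
by rewrite size_quintic.
Qed.

Lemma ddx_poly q : ddx (polyK q) = polyK q^`().
Proof.
have [e0 e1] := KcoordE (tofrac q) 0; rewrite rmorph0 mul0r addr0 in e0 e1.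
rewrite /ddx e0 e1 frac_deriv_tofrac mul0r addr0.
by rewrite -tofrac0 frac_deriv_tofrac derivC tofrac0 rmorph0 mul0r addr0.
Qed.

Lemma ddx_const c : ddx (constK c) = 0.
Proof. by rewrite ddx_poly derivC rmorph0. Qed.

Lemma ddx_xK : ddx xK = 1.
Proof. by rewrite ddx_poly derivX rmorph1. Qed.

Lemma KcoordD f h i : Kcoord (f + h) i = Kcoord f i + Kcoord h i.
Proof. by rewrite /Kcoord /= coefD. Qed.

Lemma ddxD f h : ddx (f + h) = ddx f + ddx h.
Proof.
rewrite /ddx !KcoordD !frac_derivD.
exact: ddxD_aux.
Qed.

Lemma ddxM (two_neq0 : 2 != 0 :> k) f h : ddx (f * h) = ddx f * h + f * ddx h.
Proof.
set u := tofrac G^`() / tofrac (G *+ 2).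
have G0 : G != 0 by rewrite -size_poly_eq0 size_quintic.
have G20 : G *+ 2 != 0.
  by rewrite -mulr_natr -polyC_natr mulf_neq0 // polyC_eq0.
have hu : frac_deriv (tofrac G) = u * tofrac G *+ 2.
  by rewrite frac_deriv_tofrac -mulrnAr -rmorphMn /= /u mulfVK // tofrac_eq0.
pose a := Kcoord f 0; pose b := Kcoord f 1; pose c := Kcoord h 0; pose d := Kcoord h 1.
have fhE : f * h = fracK (a * c + b * d * tofrac G) + fracK (a * d + b * c) * yK.
  rewrite {1}(Kbasis f) {1}(Kbasis h) -/a -/b -/c -/d.
  by apply: (@mulK_aux _ _ fracK); exact: yK_sqr.
have [e0 e1] := KcoordE (a * c + b * d * tofrac G) (a * d + b * c).
rewrite -fhE in e0 e1.
rewrite /ddx e0 e1 -/a -/b -/c -/d -/u.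
rewrite [X in _ = _ * X + _](Kbasis h) [X in _ = _ + X * _](Kbasis f) -/a -/b -/c -/d.
rewrite !frac_derivD !frac_derivM hu.
by apply: (@ddxM_aux _ _ fracK); exact: yK_sqr.
Qed.

Lemma thetaM (two_neq0 : 2 != 0 :> k) f h :
  theta (f * h) = theta f * h + f * theta h.
Proof. by rewrite /theta ddxM // mulrDr mulrA mulrCA. Qed.

Lemma theta_poly q : theta (polyK q) = yK * polyK q^`().
Proof. by rewrite /theta ddx_poly. Qed.

Lemma theta_xK : theta xK = yK.
Proof. by rewrite /theta ddx_xK mulr1. Qed.

Lemma theta_yK (two_neq0 : 2 != 0 :> k) : theta yK = polyK (2^-1 *: G^`()).
Proof.
have h2 : constK 2 != 0 by rewrite fmorph_eq0.
have := ddxM two_neq0 yK yK; rewrite -expr2 yK_sqr ddx_poly => e.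
apply: (mulfI h2); rewrite /theta.
transitivity (polyK G^`()); last first.
  by rewrite /constK -rmorphM /= mul_polyC scalerA divff // scale1r.
rewrite e (_ : constK 2 = 2); last by rewrite (rmorph_nat constK 2).
by rewrite mulr_natl mulr2n [ddx yK * yK]mulrC.
Qed.

(* theta^(2 n) x as a polynomial in x. *)
Fixpoint theta_even (n : nat) : {poly k} :=
  if n is m.+1 then
    (theta_even m)^`(2) * G + 2^-1 *: ((theta_even m)^`() * G^`())
  else 'X.

Lemma iter_theta_even (two_neq0 : 2 != 0 :> k) n :
  iter n.*2 theta xK = polyK (theta_even n).
Proof.
elim: n => [//|n IH]; rewrite doubleS 2!iterS {}IH /=; set q := theta_even n.
rewrite theta_poly thetaM // theta_yK // theta_poly mulrA -expr2 yK_sqr.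
rewrite -!rmorphM -rmorphD addrC [G * _]mulrC -scalerAl.
by rewrite [G^`() * _]mulrC.
Qed.

Lemma polyK_inj : injective polyK.
Proof. by move=> p q /fmorph_inj /eqP; rewrite tofrac_eq => /eqP. Qed.

Definition affine_smooth : Prop :=
  forall a b : k, b ^+ 2 = G.[a] -> b *+ 2 != 0 \/ G^`().[a] != 0.

(* The closed points of C: the affine ones, and None for the point at
   infinity. *)
Definition point := option {P : k * k | P.2 ^+ 2 == G.[P.1]}.

(* Affine charts of C: (x, y) around the affine points, and
   (1/x, y/x^3) around the point at infinity, which is (0, 0) on
   w^2 = s + a_1 s^2 + a_2 s^3 + a_3 s^4 + a_4 s^5 + a_5 s^6. *)
Definition chart (P : point) : K * K :=
  if P is Some _ then (xK, yK) else (xK^-1, yK / xK ^+ 3).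
Definition chart_value (P : point) : k * k :=
  if P is Some Q then val Q else (0, 0).

Definition uniformizer (P : point) : K :=
  if P is Some Q then
    if (val Q).2 == 0 then yK else xK - constK (val Q).1
  else yK / xK ^+ 3.

Definition evalk (P : point) (u : {poly {poly k}}) : k :=
  u.[(chart_value P).1, (chart_value P).2].
Definition evalK (P : point) (u : {poly {poly k}}) : K :=
  (map_poly (map_poly constK) u).[(chart P).1, (chart P).2].

(* has_ord P f n: f is t^n times a unit of the local ring of C at P, with t the
   chosen uniformizer; the units are the quotients u / w of polynomials in the
   chart coordinates that do not vanish at P. *)
Definition has_ord (P : point) (f : K) (n : int) : Prop :=
  exists u w : {poly {poly k}},
    [/\ evalk P u != 0, evalk P w != 0 & f * evalK P w = uniformizer P ^ n * evalK P u].

Lemma evalkM P u w : evalk P (u * w) = evalk P u * evalk P w.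
Proof. by rewrite /evalk !hornerM. Qed.

Lemma evalKM P u w : evalK P (u * w) = evalK P u * evalK P w.
Proof. by rewrite /evalK rmorphM !hornerM. Qed.

Lemma uniformizer_neq0 P : uniformizer P != 0.
Proof.
have x0 : xK != 0 by rewrite fmorph_eq0 tofrac_eq0 polyX_eq0.
case: P => [Q|] /=; last by rewrite mulf_neq0 ?invr_eq0 ?expf_neq0 ?yK_neq0.
case: ifP => _; first exact: yK_neq0.
rewrite -rmorphB fmorph_eq0 tofrac_eq0 polyXsubC_eq0 //.
Qed.

Lemma has_ord1 P : has_ord P 1 0.
Proof. by exists 1, 1; rewrite /evalk !hornerC oner_neq0 expr0z. Qed.

Lemma has_ord_div P f h m n : h != 0 ->
  has_ord P f m -> has_ord P h n -> has_ord P (f / h) (m - n).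
Proof.
move=> h0 [u [w [u0 w0 e]]] [u' [w' [u'0 w'0 e']]].
exists (u * w'), (w * u'); rewrite !evalkM !evalKM !mulf_neq0 //; split=> //.
have t0 := uniformizer_neq0 P.
have tn0 : uniformizer P ^ n != 0 by rewrite expfz_neq0.
by rewrite expfzDr // -invr_expz; exact: div_aux.
Qed.

Definition divisor := {freeg point / int}.

Definition principal (D : divisor) : Prop :=
  exists2 f : K, f != 0 & forall P, has_ord P f (coeff P D).

Definition degree_zero : {pred divisor} := fun D => deg D == 0.

Lemma degree_zero_zmod_closed : zmod_closed degree_zero.
Proof.
split=> [|D E]; rewrite !unfold_in /degree_zero ?deg0 //.
by move=> /eqP d0 /eqP e0; rewrite degB d0 e0.
Qed.
HB.instance Definition _ := GRing.isZmodClosed.Build divisor degree_zero degree_zero_zmod_closed.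

Record divisor0 := Divisor0 { divisor0_val : divisor; _ : divisor0_val \in degree_zero }.
HB.instance Definition _ := [isSub for divisor0_val].
HB.instance Definition _ := [Choice of divisor0 by <:].
HB.instance Definition _ := [SubChoice_isSubZmodule of divisor0 by <:].

Definition principal0 : {pred divisor0} := fun D => `[< principal (val D) >].

Lemma principal0_zmod_closed : zmod_closed principal0.
Proof.
split=> [|D E]; rewrite !unfold_in.
  apply/asboolP; exists 1; rewrite ?oner_neq0 // => P.
  by rewrite coeff0; exact: has_ord1.
move=> /asboolP[f f0 fD] /asboolP[h h0 hE]; apply/asboolP.
exists (f / h); rewrite ?mulf_neq0 ?invr_eq0 // => P.
have -> : val (D - E) = val D - val E by rewrite raddfB.
by rewrite coeffB; exact: has_ord_div.
Qed.
HB.instance Definition _ :=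
  GRing.isZmodClosed.Build divisor0 principal0 principal0_zmod_closed.

(* J(k) = Pic^0(C). *)
Definition jacobian : zmodType := Quotient.quot principal0.

Definition torsion (n : nat) : set jacobian := [set c | c *+ n = 0].

Definition has_p_rank (p r : nat) : Prop := (torsion p #= `I_(p ^ r))%card.

End Curve.

(* Main.v *)
From HB Require Import structures.
From mathcomp Require Import all_boot all_order all_algebra all_field.
From mathcomp Require Import ring_quotient generic_quotient polyXY fraction.
From mathcomp Require Import finmap freeg.
From mathcomp Require Import boolp classical_sets functions cardinality.
From mathcomp Require Import ring zify.
Require Import Defs.

(** The p-torsion classes of the Jacobian are counted through logarithmic
differential forms. Let D have degree zero and let p D be the divisor of a
function f. The orders of f are multiples of p, so df / f = (theta f / f) dx / y
has no poles, and a form without poles is (u + v x) dx / y with u and v constant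
(regular_twist). The function f is determined by the class of D up to constants
and p-th powers, which theta kills, so (u, v) depends on the class only
(log_form_of_fun). Conversely the kernel of theta consists of p-th powers
(theta_kernel), so (u, v) determines the class (log_form_of_inj). And if
theta f = (u + v x) f for some nonzero f, then the orders of f are multiples of p
because the form has no poles; since div f has degree zero
(has_divisor_exists), div f / p is a torsion class (log_form_of_surj). The
p-torsion is thus in bijection with the pairs (u, v) such that u + v x is a
logarithmic derivative theta f / f.

These pairs are found with Jacobson's formula: the operator (theta + h)^p is
theta^p plus multiplication by theta^(p-1) h + h^p. As theta^p is a derivation, it
is g_p' theta (theta_pchar), and h is a logarithmic derivative if and only if
theta^(p-1) h + h^p = g_p' h (log_deriv_pchar, log_deriv_exists). The derivative
g_p' is constant for theta, so g_p'' = 0 and, by its degree,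
g_p = h1 + h2 x + h3 x^p + h4 x^(p+1). For h = u + v x the equation becomes
  u^p = h2 u - h1 v,    v^p = h4 u - h3 v.
This Frobenius-linear system has p^2 solutions if its determinant h1 h4 - h2 h3 is
not zero (frob_sys_regular); if the matrix is c_i d_j, the solutions lie on one
line and there are p or 1 of them, according to whether c1 d1^p + c2 d2^p is
nonzero, which is what the two remaining expressions detect
(frob_sys_singular). *)

Set Implicit Arguments.
Unset Strict Implicit.
Unset Printing Implicit Defensive.

Import Order.TTheory GRing.Theory Num.Theory.
Local Open Scope ring_scope.

(** * Derivations in characteristic p *)

Definition derivation (R : fieldType) (D : R -> R) : Prop :=
  {morph D : x y / x + y} /\ forall x y, D (x * y) = D x * y + x * D y.

(** For q = - h, the kernel consists of the f whose logarithmic derivative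
    D f / f is h. *)
Definition twist (R : fieldType) (D : R -> R) (q f : R) : R := D f + q * f.

(** The three operators are meant to be twists of one derivation, by q + r,
    q and r. *)
Lemma iter_leibniz (R : comNzRingType) (S T U : R -> R)
    (SD : {morph S : x y / x + y}) (SM : forall f g, S (f * g) = T f * g + f * U g) n f g :
  iter n S (f * g) =
  \sum_(i < n.+1) (iter (n - i) T f * iter i U g) *+ 'C(n, i).
Proof.
have S0 : S 0 = 0 by apply: (addIr (S 0)); rewrite -SD !add0r.
have Smn x m : S (x *+ m) = S x *+ m.
  by elim: m => [|m IH]; rewrite ?mulr0n // !mulrS SD IH.
elim: n => [|n IH].
  by rewrite big_ord_recl big_ord0 subn0 /= mulr1n addr0.
rewrite iterS IH (big_morph S SD S0).
under eq_bigr => i _ do rewrite Smn SM -!iterS mulrnDl.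
rewrite big_split /= [in RHS]big_ord_recl [in RHS]bin0 subn0.
under [in RHS]eq_bigr => i _ do rewrite lift0 subSS binS mulrnDr.
rewrite big_split /= addrA; congr (_ + _).
rewrite [in RHS]big_ord_recr /= bin_small // mulr0n addr0.
rewrite big_ord_recl /= bin0 subn0; congr (_ + _).
by apply: eq_bigr => i _; rewrite /bump leq0n add1n -iterS subnSK.
Qed.

(** The inner binomial coefficients are divisible by p. *)
Lemma iter_leibniz_pchar (R : comNzRingType) (p : nat) (hp : p \in [pchar R])
    (S T U : R -> R) (SD : {morph S : x y / x + y})
    (SM : forall f g, S (f * g) = T f * g + f * U g) f g :
  iter p S (f * g) = iter p T f * g + f * iter p U g.
Proof.
have p_pr := pcharf_prime hp; have p0 := prime_gt0 p_pr.
rewrite (iter_leibniz SD SM); case: p hp p_pr p0 => // n hn p_pr _.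
rewrite big_ord_recl big_ord_recr /= big1 => [|i _]; last first.
  rewrite /bump leq0n add1n -mulr_natr (_ : _%:R = 0) ?mulr0 //.
  by apply/eqP; rewrite -(dvdn_pcharf hn) prime_dvd_bin //= ltnS ltn_ord.
by rewrite add0r /bump leq0n add1n subSS subnn bin0 binn.
Qed.

Section Derivations.
Variables (K : fieldType) (D : K -> K) (dD : derivation D).
Implicit Types (f g h q r x A : K).

Let DD : {morph D : x y / x + y} := dD.1.
Let DM : forall x y, D (x * y) = D x * y + x * D y := dD.2.

Lemma derivation0 : D 0 = 0.
Proof. by apply: (addIr (D 0)); rewrite -DD !add0r. Qed.

Lemma derivation1 : D 1 = 0.
Proof. by apply: (addIr (D 1)); rewrite add0r -{3}[1]mulr1 DM mulr1 mul1r. Qed.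

Lemma derivationN f : D (- f) = - D f.
Proof. by apply: (addIr (D f)); rewrite -DD !addNr derivation0. Qed.

Lemma derivationB f g : D (f - g) = D f - D g.
Proof. by rewrite DD derivationN. Qed.

Lemma derivation_nat n : D n%:R = 0.
Proof. by elim: n => [|n IH]; rewrite ?derivation0 // mulrS DD derivation1 IH addr0. Qed.

Lemma derivationX f n : D (f ^+ n) = n%:R * f ^+ n.-1 * D f.
Proof.
elim: n => [|[|n] IH]; first by rewrite derivation1 !mul0r.
  by rewrite !expr1 mul1r mul1r.
by rewrite exprS DM IH /= !exprS -[n.+2]addn1 natrD; ring.
Qed.

Lemma derivation_div f g : g != 0 -> D (f / g) = (D f * g - f * D g) / g ^+ 2.
Proof.
move=> g0; have -> : D f = D (f / g) * g + f / g * D g by rewrite -DM divfK.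
by field.
Qed.

Lemma log_deriv_quotient f h w : h != 0 -> D f = w * f -> D h = w * h -> D (f / h) = 0.
Proof. by move=> h0 ef eh; rewrite derivation_div // ef eh; field. Qed.

Lemma iter_derivationD n : {morph iter n D : x y / x + y}.
Proof. by elim: n => [|n IH] x y //=; rewrite IH DD. Qed.

Lemma twistD q : {morph twist D q : x y / x + y}.
Proof. by move=> x y; rewrite /twist DD; ring. Qed.

Lemma twistM q r f g : twist D (q + r) (f * g) = twist D q f * g + f * twist D r g.
Proof. by rewrite /twist DM; ring. Qed.

Variables (p : nat) (hp : p \in [pchar K]).

Lemma derivation_iter_pchar : derivation (iter p D).
Proof. by split; [exact: iter_derivationD | exact: iter_leibniz_pchar]. Qed.

(** The Leibniz rule at 1 * 1. This additivity in q stands in for an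
    expansion of (D + q)^p. *)
Lemma iter_twist_pchar q r :
  iter p (twist D (q + r)) 1 = iter p (twist D q) 1 + iter p (twist D r) 1.
Proof.
have := iter_leibniz_pchar hp (twistD (q + r)) (@twistM q r) 1 1.
by rewrite !mulr1 mul1r.
Qed.

Lemma iter_twist0 : iter p (twist D 0) 1 = 0.
Proof.
have := iter_twist_pchar 0 0; rewrite [0 + 0]addr0 => /esym e.
by apply: (addIr (iter p (twist D 0) 1)); rewrite add0r.
Qed.

Lemma iter_twistN q : iter p (twist D (- q)) 1 = - iter p (twist D q) 1.
Proof. by apply/eqP; rewrite -addr_eq0 -iter_twist_pchar addNr iter_twist0. Qed.

(** (D + q)^p - D^p is a multiplication operator, so it is determined by its
    value at 1. *)
Lemma iter_twist_mul q f :
  iter p (twist D q) f = iter p D f + iter p (twist D q) 1 * f.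
Proof.
have SM u v : twist D q (u * v) = twist D q u * v + u * D v.
  by rewrite /twist DM; ring.
have := iter_leibniz_pchar hp (twistD q) SM 1 f.
by rewrite !mul1r addrC.
Qed.

(** The twist by q V, where V is a new constant; at V = n it specializes to
    the twist by n q. *)
Definition twist_poly q (F : {poly K}) : {poly K} :=
  map_poly D F + q%:P * 'X * F.

Let coef_tp q F i :
  (twist_poly q F)`_i = D F`_i + (if i is j.+1 then q * F`_j else 0).
Proof.
rewrite coefD coef_map_id0 ?derivation0 // -mulrA coefCM.
by rewrite [X in _ + _ * X]coefXM; case: i => //=; rewrite mulr0.
Qed.

Let twist_poly_eval q F (n : nat) :
  (twist_poly q F).[n%:R] = twist D (n%:R * q) F.[n%:R].
Proof.
rewrite /twist_poly /twist hornerD !hornerM hornerC hornerX; congr (_ + _); last first.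
  by rewrite [q * _]mulrC.
rewrite (@horner_coef_wide _ (size F)) ?size_poly //.
rewrite horner_coef (big_morph D DD derivation0); apply: eq_bigr => i _.
rewrite coef_map_id0 ?derivation0 // DM -natrX derivation_nat mulr0 addr0 //.
Qed.

(** The p-th iterate of the twist by q V, applied to 1, is a polynomial in V of
    degree at most p. By additivity in q it is linear on the prime field, so it is
    c V + a (V^p - V); its coefficients in degrees p and 1 give a = q^p and
    c - a = D^(p-1) q. *)
Lemma jacobson q : iter p (twist D q) 1 = iter p.-1 D q + q ^+ p.
Proof.
have p_pr := pcharf_prime hp; have p0 := prime_gt0 p_pr.
pose F n := iter n (twist_poly q) 1.
have Fval n m : (F n).[m%:R] = iter n (twist D (m%:R * q)) 1.
  by elim: n => [|n IH]; rewrite /F ?hornerC //= twist_poly_eval IH.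
have Ftop n i : (n < i)%N -> (F n)`_i = 0.
  elim: n i => [|n IH] [|i] //=; first by rewrite coef1.
  by move=> lt_ni; rewrite coef_tp !IH ?derivation0 ?mulr0 ?addr0 // ltnW.
have Flead n : (F n)`_n = q ^+ n.
  elim: n => [|n IH] /=; first by rewrite coef1.
  by rewrite coef_tp [_`_n.+1]Ftop // [_`_n]IH derivation0 add0r exprS.
have F0 n : (F n.+1)`_0 = 0.
  elim: n => [|n IH]; rewrite /F /= coef_tp ?coef1 ?derivation1 ?addr0 //.
  by rewrite [_`_0]IH derivation0.
have F1 n : (F n.+1)`_1 = iter n D q.
  elim: n => [|n IH]; rewrite /F iterS coef_tp.
    by rewrite !coef1 /= derivation0 add0r mulr1.
  by rewrite [_`_1]IH [_`_0]F0 mulr0 addr0.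
pose c := iter p (twist D q) 1; pose a := q ^+ p.
(* Additivity in q makes F p equal to c V at the points of the prime field. *)
have Fn m : (F p).[m%:R] = m%:R * c.
  rewrite Fval; elim: m => [|m IH].
    by rewrite !mul0r iter_twist0.
  by rewrite mulrSr !mulrDl iter_twist_pchar IH !mul1r.
(* H has degree less than p and vanishes on the prime field. *)
pose H := F p - c *: 'X - a *: ('X^p - 'X).
suff H0 : H = 0.
  have := congr1 (coefp 1) H0; rewrite /coefp /H /= !(coefB, coefZ) coefX coefXn.
  rewrite -{1}(prednK p0) F1 [1%N == p]eq_sym (gtn_eqF (prime_gt1 p_pr)) /= coef0.
  rewrite sub0r mulr1 mulrN1 opprK => /eqP.
  by rewrite addrAC subr_eq0 => /eqP /esym.
apply/eqP/negPn/negP => H0.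
have szH : (size H <= p)%N.
  apply/leq_sizeP => j; rewrite leq_eqVlt => /orP [/eqP <-|lt_pj].
    rewrite /H !(coefB, coefZ) coefX coefXn eqxx Flead (gtn_eqF (prime_gt1 p_pr)).
    by rewrite !mulr0 !subr0 mulr1 subrr.
  rewrite /H !(coefB, coefZ) coefX coefXn Ftop // (gtn_eqF lt_pj).
  rewrite (gtn_eqF (leq_trans (prime_gt1 p_pr) (ltnW lt_pj))).
  by rewrite !(mulr0, subr0).
pose rs := [seq (m%:R : K) | m <- iota 0 p].
have rsP : all (root H) rs.
  apply/allP => _ /mapP [m _ ->]; rewrite /root /H !hornerE Fn.
  have -> : (m%:R : K) ^+ p = m%:R.
    by rewrite -(pFrobenius_autE hp) rmorph_nat.
  by rewrite subrr mulr0 subr0 [c * _]mulrC subrr.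
have rsU : uniq rs.
  rewrite map_inj_in_uniq ?iota_uniq // => m n; rewrite !mem_iota !add0n /=.
  wlog le_mn : m n / (m <= n)%N => [IH mp np e|mp np e].
    case/orP: (leq_total m n) => le; first exact: IH.
    by apply/esym/IH.
  have : (p %| n - m)%N by rewrite (dvdn_pcharf hp) natrB // e subrr.
  move=> dv; apply/eqP; rewrite eqn_leq le_mn -subn_eq0 eqn0Ngt; apply/negP => nm.
  by have := dvdn_leq nm dv; rewrite leqNgt (leq_ltn_trans (leq_subr _ _)).
have := max_poly_roots H0 rsP rsU; rewrite size_map size_iota ltnNge.
by rewrite szH.
Qed.

Lemma derivation_pth_power e : D (e ^+ p) = 0.
Proof. by rewrite derivationX (pcharf0 hp) !mul0r. Qed.

(** Constants and p-th powers do not contribute to a logarithmic derivative. *)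
Lemma log_deriv_pth_power f h e a w w' : f != 0 -> D a = 0 -> f = a * (h * e ^+ p) ->
  D f = w * f -> D h = w' * h -> w = w'.
Proof.
move=> f0 Da fE ef eh; apply: (mulIf f0).
by rewrite -ef {2}fE {1}fE !DM Da derivation_pth_power eh; ring.
Qed.

(** It lowers the order of a differential operator, which tells apart
    operators of different orders. *)
Definition comm_mul x (T : K -> K) : K -> K := fun f => T (x * f) - x * T f.

Lemma iter_comm_twist x q T m f :
  iter m.+1 (comm_mul x) (twist D q \o T) f =
  twist D q (iter m.+1 (comm_mul x) T f) + m.+1%:R * D x * iter m (comm_mul x) T f.
Proof.
elim: m f => [|m IH] f.
  by rewrite /comm_mul /twist /= derivationB DM; ring.
rewrite iterS {1}/comm_mul !IH.
set U := iter m.+1 _ T; set V := iter m _ T.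
have -> : iter m.+2 (comm_mul x) T f = U (x * f) - x * U f by [].
have UE : U f = V (x * f) - x * V f by [].
have -> : m.+2%:R * D x * U f = m.+1%:R * D x * (V (x * f) - x * V f) + D x * U f.
  by rewrite -UE -[m.+2]addn1 natrD; ring.
by rewrite /twist derivationB DM; ring.
Qed.

(** For an operator of order n, the n-th commutator with x is the
    multiplication by n! times the symbol, and the next one is zero. *)
Lemma iter_comm_iter_twist x q n f :
  iter n.+1 (comm_mul x) (iter n (twist D q)) f = 0 /\
  iter n (comm_mul x) (iter n (twist D q)) f = n`!%:R * D x ^+ n * f.
Proof.
elim: n f => [|n IH] f; first by rewrite /comm_mul /= subrr mulr1 mul1r.
have ext T T' (e : T =1 T') m g : iter m (comm_mul x) T g = iter m (comm_mul x) T' g.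
  by elim: m g => [|m IHm] g //=; rewrite /comm_mul !IHm.
have I1 g : iter n.+1 (comm_mul x) (iter n.+1 (twist D q)) g =
            n.+1`!%:R * D x ^+ n.+1 * g.
  rewrite (ext _ (twist D q \o iter n (twist D q))) // iter_comm_twist.
  have [-> ->] := IH g.
  by rewrite /twist derivation0 mulr0 !add0r factS natrM exprS; ring.
split; last exact: I1.
by rewrite iterS /comm_mul !I1; ring.
Qed.

Variables (A x : K).
Hypotheses (Dp : forall f, iter p D f = A * D f) (DA : D A = 0) (Dx : D x != 0).

(** D - h kills f, hence so does its p-th power, which by Jacobson's formula
    is A D - (D^(p-1) h + h^p). *)
Lemma log_deriv_pchar f h : f != 0 -> D f = h * f -> iter p.-1 D h + h ^+ p = A * h.
Proof.
move=> f0 fh; rewrite -jacobson.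
have d0 : twist D (- h) f = 0 by rewrite /twist fh mulNr subrr.
have iter0 n : iter n (twist D (- h)) 0 = 0.
  by elim: n => //= n ->; rewrite /twist derivation0 mulr0 addr0.
have := iter_twist_mul (- h) f; rewrite -{1}(prednK (prime_gt0 (pcharf_prime hp))).
rewrite iterSr d0 iter0 Dp fh => /esym/eqP.
rewrite iter_twistN mulrA -mulrDl mulf_eq0 (negPf f0) orbF subr_eq0.
by move/eqP.
Qed.

(** By Jacobson's formula T = D - h satisfies T^p = A T, and T commutes with A,
    so T kills the image of T^(p-1) - A. This operator is not zero, since p - 1
    commutators with x turn it into multiplication by (p-1)! (D x)^(p-1). *)
Lemma log_deriv_exists h : iter p.-1 D h + h ^+ p = A * h ->
  exists2 f, f != 0 & D f = h * f.
Proof.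
move=> hE; pose T := twist D (- h).
have p_pr := pcharf_prime hp; have p0 := prime_gt0 p_pr.
have Tp f : iter p T f = A * T f.
  by rewrite /T iter_twist_mul Dp iter_twistN jacobson hE /twist; ring.
have Tf g : T (iter p.-1 T g - A * g) = 0.
  rewrite /T twistD -/T -iterS prednK // Tp /T /twist derivationN DM DA.
  by ring.
have [[g gE]|noT] := pselect (exists g, iter p.-1 T g - A * g != 0).
  exists (iter p.-1 T g - A * g) => //.
  by have /eqP := Tf g; rewrite /T /twist mulNr subr_eq0 => /eqP.
have {}noT g : iter p.-1 T g = A * g.
  by apply/eqP; rewrite -subr_eq0; apply/negPn/negP => ne; apply: noT; exists g.
have [m pm] : exists m, p.-1 = m.+1.
  by exists p.-2; rewrite prednK // -ltnS prednK // prime_gt1.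
have fact_neq0 n : (n < p)%N -> n`!%:R != 0 :> K.
  elim: n => [|n IH] np; first by rewrite oner_neq0.
  rewrite factS natrM mulf_neq0 ?IH //; last exact: ltnW.
  by rewrite -(dvdn_pcharf hp) gtnNdvd.
have [_ /eqP] := iter_comm_iter_twist x (- h) p.-1 1; rewrite -/T mulr1.
have com0 l : iter l.+1 (comm_mul x) (iter p.-1 T) =1 (fun => 0).
  elim: l => [|l IH] g; first by rewrite /comm_mul /= !noT; ring.
  by rewrite iterS /comm_mul !IH mulr0 subrr.
rewrite {1}pm com0 eq_sym mulf_eq0 expf_eq0 (negPf Dx) andbF orbF.
by rewrite (negPf (fact_neq0 _ _)) // prednK.
Qed.

End Derivations.

Lemma derivationXz (K : fieldType) (D : K -> K) (dD : derivation D) (t : K) (n : int) :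
  t != 0 -> D (t ^ n) = n%:~R * t ^ n * (D t / t).
Proof.
move=> t0; case: n => n.
  rewrite -exprnP (derivationX dD) pmulrn; case: n => [|n]; first by rewrite !mul0r.
  by rewrite exprS /=; field.
rewrite NegzE -invr_expz -exprnP -div1r (derivation_div dD) ?expf_neq0 //.
rewrite (derivation1 dD) (derivationX dD) mul0r sub0r mul1r /= rmorphN /= -pmulrn.
have tn0 : t ^+ n != 0 by rewrite expf_neq0.
by rewrite !exprS; field; rewrite t0.
Qed.

(** * Local rings and orders on a chart of the curve *)

(** Coordinates (X, Y) with Y^2 = G(X) that generate K, around a smooth point
    (a, b). The derivation d is a vector field that is regular on the chart and
    does not vanish at the point. The charts around the affine points and the one
    around infinity all have this shape. *)
Record curve_chart (k K : fieldType) (c : {rmorphism k -> K}) := CurveChart {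
  chX : K; chY : K; chG : {poly k}; cha : k; chb : k; chd : K -> K; che : k;
  ch2 : 2 != 0 :> k;
  chYE : chY ^+ 2 = (map_poly c chG).[chX];
  chbE : chb ^+ 2 = chG.[cha];
  ch_smooth : chb = 0 -> chG^`().[cha] != 0;
  ch_indep : forall A B : {poly k},
    (map_poly c A).[chX] + (map_poly c B).[chX] * chY = 0 -> A = 0 /\ B = 0;
  ch_gen : forall f : K, exists A B C : {poly k}, C != 0 /\
    f * (map_poly c C).[chX] = (map_poly c A).[chX] + (map_poly c B).[chX] * chY;
  chd_deriv : derivation chd;
  chd_const : forall a, chd (c a) = 0;
  che_neq0 : che != 0;
  chdX : chd chX = c che * chY }.

Section Chart.
Variables (k K : fieldType) (c : {rmorphism k -> K}) (ch : curve_chart c).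
Local Notation X := (chX ch).
Local Notation Y := (chY ch).
Local Notation G := (chG ch).
Local Notation a0 := (cha ch).
Local Notation b0 := (chb ch).
Local Notation d := (chd ch).

Definition ev (A : {poly k}) : K := (map_poly c A).[X].

Lemma ev_is_zmod_morphism : zmod_morphism ev.
Proof. by move=> A B; rewrite /ev rmorphB hornerD hornerN. Qed.
HB.instance Definition _ :=
  GRing.isZmodMorphism.Build _ _ ev ev_is_zmod_morphism.
Lemma ev_is_monoid_morphism : monoid_morphism ev.
Proof. by split=> [|A B]; rewrite /ev ?rmorph1 ?hornerC // rmorphM hornerM. Qed.
HB.instance Definition _ :=
  GRing.isMonoidMorphism.Build _ _ ev ev_is_monoid_morphism.

Lemma evC a : ev a%:P = c a. Proof. by rewrite /ev map_polyC hornerC. Qed.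
Lemma evX : ev 'X = X. Proof. by rewrite /ev map_polyX hornerX. Qed.
Lemma YE : Y ^+ 2 = ev G. Proof. exact: chYE. Qed.

Definition coord_value (f : K) (v : k) : Prop :=
  exists A B, f = ev A + ev B * Y /\ v = A.[a0] + B.[a0] * b0.

Lemma coord_ev A : coord_value (ev A) A.[a0].
Proof. by exists A, 0; rewrite rmorph0 hornerC !mul0r !addr0. Qed.

Lemma coordC a : coord_value (c a) a.
Proof. by rewrite -evC -[X in coord_value _ X](hornerC a a0); exact: coord_ev. Qed.

Lemma coordX : coord_value X a0.
Proof. by rewrite -evX -[X in coord_value _ X]hornerX; exact: coord_ev. Qed.

Lemma coordY : coord_value Y b0.
Proof. by exists 0, 1; rewrite rmorph0 rmorph1 !hornerC !mul1r !add0r. Qed.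

Lemma coordD f g v w : coord_value f v -> coord_value g w -> coord_value (f + g) (v + w).
Proof.
move=> [A [B [-> ->]]] [A' [B' [-> ->]]]; exists (A + A'), (B + B').
by rewrite !rmorphD /= !hornerD; split; ring.
Qed.

Lemma coordM f g v w : coord_value f v -> coord_value g w -> coord_value (f * g) (v * w).
Proof.
move=> [A [B [-> ->]]] [A' [B' [-> ->]]].
exists (A * A' + B * B' * G), (A * B' + A' * B).
rewrite !rmorphD /= !rmorphM /= !hornerE -YE -chbE; split; ring.
Qed.

Lemma coordN f v : coord_value f v -> coord_value (- f) (- v).
Proof.
by move=> /(coordM (coordC (-1))); rewrite rmorphN1 !mulN1r.
Qed.

(** 1 and Y are independent over k[X], so evaluation at the point is well
    defined on the coordinate ring. *)
Lemma coord_eq0 v : coord_value 0 v -> v = 0.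
Proof.
move=> [A [B [/esym e ->]]]; have [-> ->] := ch_indep e.
by rewrite !hornerC mul0r addr0.
Qed.

Lemma coord_neq0 f v : coord_value f v -> v != 0 -> f != 0.
Proof. by move=> fv; apply: contraNneq => f0; apply/eqP/coord_eq0; rewrite -f0. Qed.

Lemma coord_fun f v w : coord_value f v -> coord_value f w -> v = w.
Proof.
move=> fv /coordN fw; apply/eqP; rewrite -subr_eq0; apply/eqP/coord_eq0.
by rewrite -(subrr f); exact: coordD.
Qed.

(** f belongs to the local ring of the point, and v is its residue class. *)
Definition has_value (f : K) (v : k) : Prop := exists n d nv dv,
  [/\ coord_value n nv, coord_value d dv, dv != 0, f * d = n & v = nv / dv].

Lemma has_value_coord f v : coord_value f v -> has_value f v.
Proof.
move=> fv; exists f, 1, v, 1; rewrite !mulr1 divr1 oner_neq0; split=> //.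
by rewrite -(rmorph1 c); exact: coordC.
Qed.

Lemma has_valueC a : has_value (c a) a. Proof. exact/has_value_coord/coordC. Qed.
Lemma has_value1 : has_value 1 1. Proof. by rewrite -(rmorph1 c); exact: has_valueC. Qed.
Lemma has_value0 : has_value 0 0. Proof. by rewrite -(rmorph0 c); exact: has_valueC. Qed.
Lemma has_value_ev A : has_value (ev A) A.[a0]. Proof. exact/has_value_coord/coord_ev. Qed.
Lemma has_valueX : has_value X a0. Proof. exact/has_value_coord/coordX. Qed.
Lemma has_valueY : has_value Y b0. Proof. exact/has_value_coord/coordY. Qed.

Lemma has_valueD f g v w : has_value f v -> has_value g w -> has_value (f + g) (v + w).
Proof.
move=> [n [e [nv [ev [n1 e1 ev0 fE ->]]]]] [m [h [mv [hv [m1 h1 hv0 gE ->]]]]].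
exists (n * h + m * e), (e * h), (nv * hv + mv * ev), (ev * hv).
split; [|exact: coordM|by rewrite mulf_neq0| |by field; rewrite ev0 hv0].
  by apply: coordD; apply: coordM.
by rewrite -fE -gE; ring.
Qed.

Lemma has_valueM f g v w : has_value f v -> has_value g w -> has_value (f * g) (v * w).
Proof.
move=> [n [e [nv [ev [n1 e1 ev0 fE ->]]]]] [m [h [mv [hv [m1 h1 hv0 gE ->]]]]].
exists (n * m), (e * h), (nv * mv), (ev * hv).
split; [exact: coordM|exact: coordM|by rewrite mulf_neq0| |by field; rewrite ev0 hv0].
by rewrite -fE -gE; ring.
Qed.

Lemma has_valueN f v : has_value f v -> has_value (- f) (- v).
Proof. by move=> /(has_valueM (has_valueC (-1))); rewrite rmorphN1 !mulN1r. Qed.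

Lemma has_valueB f g v w : has_value f v -> has_value g w -> has_value (f - g) (v - w).
Proof. by move=> fv /has_valueN; exact: has_valueD. Qed.

Lemma has_valueXn f v n : has_value f v -> has_value (f ^+ n) (v ^+ n).
Proof.
by move=> fv; elim: n => [|n IH]; [exact: has_value1|rewrite !exprS; exact: has_valueM].
Qed.

Lemma has_value_fun f v w : has_value f v -> has_value f w -> v = w.
Proof.
move=> [n [e [nv [ev [n1 e1 ev0 fE ->]]]]] [m [h [mv [hv [m1 h1 hv0 gE ->]]]]].
apply/eqP; rewrite eqr_div //; apply/eqP.
apply: (@coord_fun (f * e * h)).
  by rewrite fE; exact: coordM.
by rewrite mulrAC gE; exact: coordM.
Qed.

Lemma has_value_neq0 f v : has_value f v -> v != 0 -> f != 0.
Proof.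
move=> fv; apply: contraNneq => f0; apply/eqP; rewrite f0 in fv.
exact: has_value_fun fv has_value0.
Qed.

Lemma has_valueV f v : has_value f v -> v != 0 -> has_value f^-1 v^-1.
Proof.
move=> fv v0; have f0 := has_value_neq0 fv v0.
case: fv v0 => [n [e [nv [ev [n1 e1 ev0 fE ->]]]]].
rewrite mulf_eq0 invr_eq0 negb_or => /andP [nv0 _].
exists e, n, ev, nv; rewrite invf_div; split=> //.
by rewrite -fE mulKf.
Qed.

Lemma has_value_div f g v w : has_value f v -> has_value g w -> w != 0 -> has_value (f / g) (v / w).
Proof. by move=> fv gw w0; apply: has_valueM fv (has_valueV gw w0). Qed.

Definition chart_unif : K := if b0 == 0 then Y else X - c a0.

Lemma has_value_unif : has_value chart_unif 0.
Proof.
rewrite /chart_unif; case: eqP => [b00|_]; first by have := has_valueY; rewrite b00.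
by rewrite -(subrr a0); apply: has_valueB has_valueX (has_valueC _).
Qed.

Lemma ev_eq0 A : (ev A == 0) = (A == 0).
Proof.
apply/eqP/eqP => [e|->]; last exact: rmorph0.
have e' : ev A + ev 0 * Y = 0 by rewrite rmorph0 mul0r addr0.
by have [] := ch_indep e'.
Qed.

Lemma chY_neq0 : Y != 0.
Proof.
apply/eqP => Y0; have e : ev 0 + ev 1 * Y = 0 by rewrite Y0 rmorph0 mulr0 addr0.
have [_ /eqP] := ch_indep e; by rewrite oner_eq0.
Qed.

Lemma evXsubC a : ev ('X - a%:P) = X - c a.
Proof. by rewrite rmorphB /= evX evC. Qed.

Lemma unif_neq0 : chart_unif != 0.
Proof.
rewrite /chart_unif; case: (b0 =P 0) => _; first exact: chY_neq0.
by rewrite -evXsubC ev_eq0 polyXsubC_eq0.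
Qed.

Lemma unifz_neq0 (n : int) : chart_unif ^ n != 0.
Proof. by rewrite expfz_neq0 // unif_neq0. Qed.

Definition has_order (f : K) (n : int) : Prop :=
  exists e v, [/\ v != 0, has_value e v & f = chart_unif ^ n * e].

Lemma has_value_order0 f v : has_value f v -> v != 0 -> has_order f 0.
Proof. by move=> fv v0; exists f, v; rewrite expr0z mul1r. Qed.

Lemma has_order_unif : has_order chart_unif 1.
Proof. by exists 1, 1; rewrite oner_neq0 expr1z mulr1; split=> //; exact: has_value1. Qed.

Lemma has_orderM f g m n : has_order f m -> has_order g n -> has_order (f * g) (m + n).
Proof.
move=> [e [v [v0 ev ->]]] [h [w [w0 hw ->]]]; exists (e * h), (v * w).
by rewrite mulf_neq0 // expfzDr ?unif_neq0 // mulrACA; split=> //; exact: has_valueM.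
Qed.

Lemma has_orderV f m : has_order f m -> has_order f^-1 (- m).
Proof.
move=> [e [v [v0 ev ->]]]; exists e^-1, v^-1; rewrite invr_eq0 v0 invfM invr_expz.
by split=> //; exact: has_valueV.
Qed.

Lemma has_order_div f g m n : has_order f m -> has_order g n -> has_order (f / g) (m - n).
Proof. by move=> fm gn; apply: has_orderM fm (has_orderV gn). Qed.

Lemma has_orderX f m n : has_order f m -> has_order (f ^+ n) (m *+ n).
Proof.
move=> fm; elim: n => [|n IH]; first by apply: has_value_order0 has_value1 (oner_neq0 _).
by rewrite exprS mulrS; exact: has_orderM.
Qed.

Lemma has_value_unifXn n : (0 < n)%N -> has_value (chart_unif ^+ n) 0.
Proof. by case: n => // n _; have /(has_valueXn n.+1) := has_value_unif; rewrite expr0n. Qed.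

Lemma has_order_fun f m n : has_order f m -> has_order f n -> m = n.
Proof.
wlog le_mn : m n / m <= n.
  move=> IH fm fn; case: (leP m n) => [le|/ltW le]; first exact: IH.
  by apply/esym/IH.
move=> [e [v [v0 ev fE]]] [h [w [w0 hw]]]; rewrite fE => e1.
have [q nE] : exists q : nat, n = m + q%:Z.
  by exists `|n - m|%N; rewrite gez0_abs ?subr_ge0 //; ring.
move: e1; rewrite nE expfzDr ?unif_neq0 // -mulrA => /(mulfI (unifz_neq0 m)).
case: q {nE le_mn} => [|q] eE; first by rewrite addr0.
have : has_value e 0.
  by rewrite eE -(mul0r w); apply: has_valueM hw; exact: has_value_unifXn.
by move/(has_value_fun ev) => v00; rewrite v00 eqxx in v0.
Qed.

Lemma has_order_ge0_value f n : has_order f n -> 0 <= n -> exists v, has_value f v.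
Proof.
case: n => // n [e [v [v0 ev ->]]] _; rewrite -exprnP.
exists (0 ^+ n * v); apply: has_valueM ev; apply: has_valueXn; exact: has_value_unif.
Qed.

Lemma has_order_gt0_value f n : has_order f n -> 0 < n -> has_value f 0.
Proof.
case: n => // -[] // n [e [v [v0 ev ->]]] _; rewrite -exprnP.
by rewrite -(mul0r v); apply: has_valueM ev; exact: has_value_unifXn.
Qed.

Lemma has_value_order_ge0 f v n : has_value f v -> has_order f n -> 0 <= n.
Proof.
case: n => // n fv fn; exfalso.
have /has_orderV := fn; rewrite NegzE opprK => /has_order_gt0_value -/(_ isT) /(has_valueM fv).
rewrite mulr0 mulfV; last first.
  by case: fn => [e [w [w0 ew ->]]]; rewrite mulf_neq0 ?(has_value_neq0 ew) ?unifz_neq0.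
by move/(has_value_fun has_value1)/eqP; rewrite oner_eq0.
Qed.

Lemma G_ramified : b0 = 0 -> exists2 G1, G = ('X - a0%:P) * G1 & G1.[a0] != 0.
Proof.
move=> b00; have : root G a0 by rewrite /root -chbE b00 expr0n.
case/factor_theorem => G1 GE; exists G1; first by rewrite GE mulrC.
have := ch_smooth b00; rewrite GE derivM derivXsubC !hornerE subrr mulr0 add0r.
by [].
Qed.

(** If b = 0, then G = (X - a) G1 and X - a is Y^2 divided by the unit
    G1(X). *)
Lemma has_order_XsubC : has_order (X - c a0) (if b0 == 0 then 2 else 1).
Proof.
have := has_order_unif; rewrite /chart_unif; case: eqP => // b00 oY.
have [G1 GE G10] := G_ramified b00.
have -> : X - c a0 = Y ^+ 2 / ev G1.
  rewrite YE GE rmorphM /= evXsubC mulfK // ev_eq0.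
  by apply: contraNneq G10 => ->; rewrite hornerC.
rewrite -[2]subr0; apply: has_order_div; [exact: (has_orderX 2 oY)|].
exact: has_value_order0 (has_value_ev _) _.
Qed.

Lemma has_order_ev C : C != 0 -> exists n, has_order (ev C) n.
Proof.
move=> C0; have [m [q]] := multiplicity_XsubC C a0.
rewrite C0 /= => q0 ->; eexists; rewrite rmorphM rmorphXn /= evXsubC; apply: has_orderM.
  by apply: has_value_order0 (has_value_ev q) _; exact: q0.
exact/has_orderX/has_order_XsubC.
Qed.

(** Remove the powers of X - a that A and B have in common. Then f is a unit,
    or its conjugate A - B Y is a unit and f has the order of its norm, or b = 0
    and f is Y times a unit. *)
Lemma has_order_coord A B : ev A + ev B * Y != 0 -> exists n, has_order (ev A + ev B * Y) n.
Proof.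
have [m] := ubnP (size A + size B); elim: m A B => // m IH A B lt_m f0.
have locf : has_value (ev A + ev B * Y) (A.[a0] + B.[a0] * b0).
  by apply: has_valueD (has_value_ev A) (has_valueM (has_value_ev B) has_valueY).
case: (eqVneq (A.[a0] + B.[a0] * b0) 0) => [v0|v0]; last first.
  by exists 0; exact: has_value_order0 locf v0.
have [/andP [rA rB]|nr] := boolP (root A a0 && root B a0).
  have /factor_theorem [A1 AE] := rA; have /factor_theorem [B1 BE] := rB.
  have fE : ev A + ev B * Y = (X - c a0) * (ev A1 + ev B1 * Y).
    by rewrite AE BE !rmorphM /= evXsubC; ring.
  have sz (P Q : {poly k}) : P = Q * ('X - a0%:P) ->
      (size Q <= size P)%N /\ (P != 0 -> (size Q < size P)%N).
    move=> ->; have [->|Q0] := eqVneq Q 0; first by rewrite mul0r size_poly0 eqxx.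
    by rewrite size_Mmonic ?monicXsubC // size_XsubC addn2 /= leqnSn ltnSn.
  have [le1 lt1] := sz _ _ AE; have [le2 lt2] := sz _ _ BE.
  have lt : (size A1 + size B1 < m)%N.
    apply: leq_trans (lt_m : (size A + size B <= m)%N).
    have [A0|A0] := eqVneq A 0; last by rewrite -addSn leq_add // lt1.
    have [B0|B0] := eqVneq B 0; last by rewrite -addnS leq_add // lt2.
    by move: f0; rewrite A0 B0 rmorph0 mul0r addr0 eqxx.
  have g0 : ev A1 + ev B1 * Y != 0 by apply: contraNneq f0; rewrite fE => ->; rewrite mulr0.
  have [n on] := IH _ _ lt g0.
  by rewrite fE; eexists; exact: has_orderM has_order_XsubC on.
(* At a ramified point Y is the uniformizer and divides A. *)
have [b00|b0n] := eqVneq b0 0.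
  move: v0 nr; rewrite b00 mulr0 addr0 => A0; rewrite /root A0 eqxx /= => B0.
  have [G1 GE G10] := G_ramified b00.
  have /factor_theorem [A1 AE] : root A a0 by rewrite /root A0.
  have G10' : ev G1 != 0.
    by rewrite ev_eq0; apply: contraNneq G10 => ->; rewrite hornerC.
  have YE' : Y ^+ 2 = ev ('X - a0%:P) * ev G1 by rewrite YE {1}GE rmorphM.
  have -> : ev A + ev B * Y = Y * (ev B + ev A1 / ev G1 * Y).
    apply: (mulIf G10'); rewrite AE rmorphM /= !(mulrDl, mulrDr).
    transitivity (ev A1 * (ev ('X - a0%:P) * ev G1) + ev B * Y * ev G1); first by ring.
    by rewrite -YE'; field.
  have oY : has_order Y 1 by have := has_order_unif; rewrite /chart_unif b00 eqxx.
  exists (1 + 0); apply: has_orderM oY (has_value_order0 _ B0).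
  rewrite -[B.[a0]]addr0 -(mulr0 (A1.[a0] / G1.[a0])).
  apply: has_valueD (has_value_ev _) _.
  apply: has_valueM (has_value_div (has_value_ev _) (has_value_ev _) G10) _.
  by have := has_valueY; rewrite b00.
(* Elsewhere the conjugate of f is a unit, so f has the order of its norm. *)
have conj0 : A.[a0] - B.[a0] * b0 != 0.
  apply: contraNneq nr => e; rewrite /root.
  have : 2 * (B.[a0] * b0) = 0.
    by rewrite mulr_natl mulr2n -{1}[B.[a0] * b0](subKr A.[a0]) e subr0.
  move/eqP; rewrite !mulf_eq0 (negPf (ch2 ch)) (negPf b0n) orbF /= => /eqP B0.
  by move: v0; rewrite B0 mul0r addr0 => ->; rewrite eqxx.
have locg : has_value (ev A - ev B * Y) (A.[a0] - B.[a0] * b0).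
  by apply: has_valueB (has_value_ev A) (has_valueM (has_value_ev B) has_valueY).
have g0 := has_value_neq0 locg conj0.
have fE : ev A + ev B * Y = ev (A ^+ 2 - B ^+ 2 * G) / (ev A - ev B * Y).
  by apply/(mulIf g0); rewrite divfK // !expr2 rmorphB !rmorphM /= -YE; ring.
have [n on] : exists n, has_order (ev (A ^+ 2 - B ^+ 2 * G)) n.
  apply: has_order_ev; rewrite -ev_eq0; apply: contraNneq f0 => e.
  by rewrite fE e mul0r.
by rewrite fE; eexists; apply: has_order_div on (has_value_order0 locg conj0).
Qed.

Lemma has_order_exists f : f != 0 -> exists n, has_order f n.
Proof.
move=> f0; have [A [B [C [C0 fE]]]] := ch_gen ch f.
have C0' : ev C != 0 by rewrite ev_eq0.
have g0 : ev A + ev B * Y != 0 by rewrite /ev -fE mulf_neq0.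
have [n on] := has_order_coord g0; have [m om] := has_order_ev C0.
have -> : f = (ev A + ev B * Y) / ev C by rewrite /ev -fE mulfK.
by eexists; exact: has_order_div on om.
Qed.

Let dD := chd_deriv ch.

Lemma d_ev A : d (ev A) = ev A^`() * (c (che ch) * Y).
Proof.
elim/poly_ind: A => [|A a IH]; first by rewrite derivC !rmorph0 (derivation0 dD) mul0r.
rewrite derivMXaddC !rmorphD /= !rmorphM /= evX evC.
by rewrite dD.1 dD.2 IH chdX chd_const; ring.
Qed.

Lemma two_neq0 : 2 != 0 :> K.
Proof. by rewrite -(rmorph_nat c) fmorph_eq0 (ch2 ch). Qed.

Lemma d_Y : d Y = c (che ch / 2) * ev G^`().
Proof.
have := d_ev G; rewrite -YE expr2 dD.2 => e.
have Y0 := chY_neq0; have t0 := two_neq0.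
apply: (mulfI t0); apply: (mulIf Y0); rewrite fmorph_div rmorph_nat /=.
transitivity (d Y * Y + Y * d Y); first by ring.
by rewrite e; field.
Qed.

Lemma coord_d f v : coord_value f v -> exists w, coord_value (d f) w.
Proof.
move=> [A [B [-> _]]]; eexists.
rewrite dD.1 dD.2 !d_ev d_Y.
do ?[apply: coordD | apply: coordM |exact: coord_ev|exact: coordC|exact: coordY].
Qed.

Lemma has_value_d f v : has_value f v -> exists w, has_value (d f) w.
Proof.
move=> [n [e [nv [ev [n1 e1 ev0 fE _]]]]].
have e0 := coord_neq0 e1 ev0.
have -> : f = n / e by rewrite -fE mulfK.
have [w1 n2] := coord_d n1; have [w2 e2] := coord_d e1.
rewrite (derivation_div dD) //; eexists; apply: has_value_div; last exact: expf_neq0 2 ev0.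
  by apply: has_valueB; apply: has_valueM; apply: has_value_coord; eassumption.
by apply: has_valueXn; exact: has_value_coord e1.
Qed.

(** Smoothness makes this a unit: if b = 0, then d Y is a multiple of G'(X),
    and otherwise d X is a multiple of Y. *)
Lemma has_value_d_unif : exists2 v, v != 0 & has_value (d chart_unif) v.
Proof.
rewrite /chart_unif; case: eqP => [b00|/eqP b0n].
  exists (che ch / 2 * G^`().[a0]).
    by rewrite !mulf_neq0 ?invr_eq0 ?(ch2 ch) ?che_neq0 ?ch_smooth.
  by rewrite d_Y; apply: has_valueM (has_valueC _) (has_value_ev _).
exists (che ch * b0); first by rewrite mulf_neq0 ?che_neq0.
by rewrite (derivationB dD) chd_const subr0 chdX; apply: has_valueM (has_valueC _) has_valueY.
Qed.

Let logd f n e : f = chart_unif ^ n * e -> e != 0 ->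
  d f / f = n%:~R * (d chart_unif / chart_unif) + d e / e.
Proof.
move=> -> e0; rewrite dD.2 (derivationXz dD) ?unif_neq0 //.
have := unifz_neq0 n; move: (chart_unif ^ n) => u u0; have t0 := unif_neq0.
by field; rewrite e0 t0.
Qed.

(** If f = t^n e with e a unit, then d f / f = n d t / t + d e / e, and only the
    first term can have a pole. *)
Lemma has_value_logd f n : has_order f n -> n%:~R = 0 :> k -> exists v, has_value (d f / f) v.
Proof.
move=> [e [v [v0 ev fE]]] n0; have e0 := has_value_neq0 ev v0.
rewrite (logd fE e0) -(rmorph_int c) n0 rmorph0 mul0r add0r.
by have [w dw] := has_value_d ev; exists (w / v); exact: has_value_div.
Qed.

(** If f = t^n e with e a unit, then n d t = t (d f / f - d e / e) vanishes at
    the point, and d t does not. *)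
Lemma order_of_logd_value f n v : has_order f n -> has_value (d f / f) v -> n%:~R = 0 :> k.
Proof.
move=> [e [w [w0 ew fE]]]; have e0 := has_value_neq0 ew w0.
rewrite (logd fE e0) => fv; have [w' dw] := has_value_d ew.
have := has_valueM has_value_unif (has_valueB fv (has_value_div dw ew w0)).
rewrite addrK mulrCA [chart_unif * _]mulrC divfK ?unif_neq0 // mul0r -(rmorph_int c).
have [u u0 tu] := has_value_d_unif.
move/(has_value_fun (has_valueM (has_valueC _) tu))/eqP.
by rewrite mulf_eq0 (negPf u0) orbF => /eqP.
Qed.

Definition ev2k (u : {poly {poly k}}) : k := u.[a0, b0].
Definition ev2K (u : {poly {poly k}}) : K := (map_poly (map_poly c) u).[X, Y].

Lemma coord_ev2 u : coord_value (ev2K u) (ev2k u).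
Proof.
rewrite /ev2K /ev2k; elim/poly_ind: u => [|u a IH].
  by rewrite (rmorph0 (map_poly (map_poly c))) !hornerC -(rmorph0 c); exact: coordC.
rewrite (rmorphD (map_poly (map_poly c))) (rmorphM (map_poly (map_poly c))) /=.
rewrite map_polyX map_polyC !hornerE.
apply: coordD; first by apply: coordM IH coordX.
rewrite -[X in coord_value X.[_] _]/(map_poly c a).
elim/poly_ind: a => [|a b IHa].
  by rewrite (rmorph0 (map_poly c)) !hornerC -(rmorph0 c); exact: coordC.
rewrite rmorphD rmorphM /= map_polyX map_polyC !hornerE.
by apply: coordD (coordC _); apply: coordM IHa coordY.
Qed.

Lemma ev2_coord f v : coord_value f v -> exists2 u, ev2K u = f & ev2k u = v.
Proof.
move=> [A [B [-> ->]]].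
have E P : exists2 u, ev2K u = ev P & ev2k u = P.[a0].
  elim/poly_ind: P => [|P a [u uK uk]].
    by exists 0; rewrite /ev2K /ev2k ?(rmorph0 (map_poly (map_poly c))) ?rmorph0 !hornerC.
  exists (u * 'X + a%:P%:P).
    rewrite /ev2K rmorphD rmorphM /= map_polyX !map_polyC /= !hornerE -/(ev2K u) uK.
    by rewrite map_polyC hornerC rmorphD rmorphM /= evX evC.
  by rewrite /ev2k !hornerE -/(ev2k u) uk.
have [u uK uk] := E A; have [w wK wk] := E B; exists (u + w * 'X%:P).
  rewrite /ev2K rmorphD rmorphM /= map_polyC /= map_polyX !hornerE.
  by rewrite -/(ev2K u) -/(ev2K w) uK wK.
by rewrite /ev2k !hornerE -/(ev2k u) -/(ev2k w) uk wk.
Qed.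

Lemma has_orderE f n : has_order f n <-> exists u w,
  [/\ ev2k u != 0, ev2k w != 0 & f * ev2K w = chart_unif ^ n * ev2K u].
Proof.
split.
  move=> [e [v [v0 [m [h [mv [hv [m1 h1 hv0 eE vE]]]]] ->]]].
  have [u uE uv] := ev2_coord m1; have [w wE wv] := ev2_coord h1.
  exists u, w; rewrite uE wE uv wv -mulrA eE; split=> //.
  by apply: contraNneq v0; rewrite vE => ->; rewrite mul0r.
move=> [u [w [u0 w0 e]]]; exists (ev2K u / ev2K w), (ev2k u / ev2k w).
split; first by rewrite mulf_neq0 ?invr_eq0.
  by apply: has_value_div => //; exact/has_value_coord/coord_ev2.
by rewrite mulrA -e mulfK // (coord_neq0 (coord_ev2 w)).
Qed.

End Chart.

(** * Charts at the points of the curve *)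

(** X^n A(1/X), for n at least the degree of A. *)
Definition reverse_poly (k : fieldType) n (A : {poly k}) : {poly k} := \poly_(j < n.+1) A`_(n - j).

Lemma reverse_poly_eval (k K : fieldType) (c : {rmorphism k -> K}) n (A : {poly k}) (t : K) :
  t != 0 -> (size A <= n.+1)%N ->
  (map_poly c (reverse_poly n A)).[t^-1] = (map_poly c A).[t] / t ^+ n.
Proof.
move=> t0 szA; rewrite (@horner_coef_wide _ n.+1); last first.
  by rewrite (leq_trans (size_poly _ _)) // size_poly.
rewrite (@horner_coef_wide _ n.+1 (map_poly c A)); last first.
  by rewrite (leq_trans (size_poly _ _)).
rewrite mulr_suml (reindex_inj rev_ord_inj) /=; apply: eq_bigr => i _.
rewrite !coef_map /= coef_poly subSS ltnS leq_subr subKn ?leq_ord // -mulrA.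
congr (_ * _); rewrite exprVn -[X in _ / t ^+ X](subnK (leq_ord i)) exprD.
by field; rewrite !expf_neq0.
Qed.

Lemma reverse_poly_eq0 (k : fieldType) n (A : {poly k}) :
  (size A <= n.+1)%N -> reverse_poly n A = 0 -> A = 0.
Proof.
move=> szA r0; apply/polyP => i; rewrite coef0; have [lt_in|le_ni] := ltnP i n.+1; last first.
  by rewrite nth_default // (leq_trans szA).
have := congr1 (coefp (n - i)) r0; rewrite /coefp /= coef_poly coef0.
by rewrite ltnS leq_subr subKn.
Qed.

Lemma reverse_poly0 (k : fieldType) n (A : {poly k}) : (reverse_poly n A).[0] = A`_n.
Proof. by rewrite horner_coef0 coef_poly subn0. Qed.

(** The function field of y^2 = g(x) enters only through its generators x
    and y, the derivation theta and the involution y -> -y. *)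
Record curve_model (k : fieldType) (g : quintic k) (K : fieldType) := CurveModel {
  m_cst : {rmorphism k -> K};
  mx : K; my : K;
  m_theta : K -> K;
  m_conj : {rmorphism K -> K};
  myE : my ^+ 2 = (map_poly m_cst g).[mx];
  m_indep : forall A B : {poly k},
    (map_poly m_cst A).[mx] + (map_poly m_cst B).[mx] * my = 0 -> A = 0 /\ B = 0;
  m_gen : forall f : K, exists A B C : {poly k}, C != 0 /\
    f * (map_poly m_cst C).[mx] = (map_poly m_cst A).[mx] + (map_poly m_cst B).[mx] * my;
  theta_deriv : derivation m_theta;
  theta_cst : forall a, m_theta (m_cst a) = 0;
  theta_mx : m_theta mx = my;
  conj_cst : forall a, m_conj (m_cst a) = m_cst a;
  conj_mx : m_conj mx = mx;
  conj_my : m_conj my = - my }.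

Section Model.
Variables (k : fieldType) (g : quintic k) (K : fieldType) (M : curve_model g K).
Hypothesis two0 : 2 != 0 :> k.
Hypothesis C_smooth : affine_smooth g.
Local Notation c := (m_cst M).
Local Notation x := (mx M).
Local Notation y := (my M).
Local Notation th := (m_theta M).

Definition px (A : {poly k}) : K := (map_poly c A).[x].

Lemma px_is_zmod_morphism : zmod_morphism px.
Proof. by move=> A B; rewrite /px rmorphB hornerD hornerN. Qed.
HB.instance Definition _ :=
  GRing.isZmodMorphism.Build _ _ px px_is_zmod_morphism.
Lemma px_is_monoid_morphism : monoid_morphism px.
Proof. by split=> [|A B]; rewrite /px ?rmorph1 ?hornerC // rmorphM hornerM. Qed.
HB.instance Definition _ :=
  GRing.isMonoidMorphism.Build _ _ px px_is_monoid_morphism.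

Lemma pxC a : px a%:P = c a. Proof. by rewrite /px map_polyC hornerC. Qed.
Lemma pxX : px 'X = x. Proof. by rewrite /px map_polyX hornerX. Qed.
Lemma yE : y ^+ 2 = px g. Proof. exact: myE. Qed.

Lemma px_indep A B : px A + px B * y = 0 -> A = 0 /\ B = 0.
Proof. exact: m_indep. Qed.

Lemma px_eq0 A : (px A == 0) = (A == 0).
Proof.
apply/eqP/eqP => [e|->]; last exact: rmorph0.
by have [] := @px_indep A 0 _; rewrite // rmorph0 mul0r addr0.
Qed.

Lemma px_inj : injective px.
Proof. by move=> A B /eqP; rewrite -subr_eq0 -rmorphB px_eq0 subr_eq0 => /eqP. Qed.

Lemma x_neq0 : x != 0.
Proof. by rewrite -pxX px_eq0 polyX_eq0. Qed.

Lemma y_neq0 : y != 0.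
Proof.
apply/eqP => y0; have [_ /eqP] : (0 : {poly k}) = 0 /\ (1 : {poly k}) = 0.
  by apply: px_indep; rewrite y0 mulr0 rmorph0 addr0.
by rewrite oner_eq0.
Qed.

Lemma smooth_root a b : b ^+ 2 = g.[a] -> b = 0 -> g^`().[a] != 0.
Proof. by move=> e b0; case: (C_smooth e) => //; rewrite b0 mul0rn eqxx. Qed.

Lemma theta_x_affine : th x = c 1 * y.
Proof. by rewrite theta_mx rmorph1 mul1r. Qed.

Definition chart_affine (a b : k) (e : b ^+ 2 = g.[a]) : curve_chart c :=
  CurveChart two0 (myE M) e (smooth_root e) (@m_indep _ _ _ M) (m_gen M)
    (theta_deriv M) (theta_cst M) (oner_neq0 k) theta_x_affine.

Definition Ginf : {poly k} := reverse_poly 6 g.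

Local Notation evinf A := ((map_poly c A).[x^-1]).

Lemma evinf_reverse n (A : {poly k}) : (size A <= n.+1)%N ->
  evinf (reverse_poly n A) = px A / x ^+ n.
Proof. by move=> szA; rewrite reverse_poly_eval ?x_neq0. Qed.

Lemma evinf_px n (A : {poly k}) : (size A <= n.+1)%N -> evinf A = px (reverse_poly n A) / x ^+ n.
Proof.
move=> szA; rewrite /px -{2}[x]invrK reverse_poly_eval ?invr_eq0 ?x_neq0 //.
by rewrite exprVn invrK mulfK ?expf_neq0 // x_neq0.
Qed.

Lemma Ginf_eq : (y / x ^+ 3) ^+ 2 = evinf Ginf.
Proof. by rewrite evinf_reverse ?size_quintic // -yE expr_div_n -exprM. Qed.

Lemma Ginf0 : 0 ^+ 2 = Ginf.[0].
Proof. by rewrite reverse_poly0 nth_default ?size_quintic ?expr0n. Qed.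

Lemma Ginf_smooth : Ginf^`().[0] != 0.
Proof.
rewrite horner_coef0 coef_deriv coef_poly /= mulr1n.
have -> : g`_5 = lead_coef g by rewrite lead_coefE size_quintic.
by rewrite lead_coef_eq0 -size_poly_eq0 size_quintic.
Qed.

(** A power of x clears the denominators, which turns polynomials in 1/x into
    polynomials in x. *)
Lemma inf_indep (A B : {poly k}) : evinf A + evinf B * (y / x ^+ 3) = 0 -> A = 0 /\ B = 0.
Proof.
have x0 := x_neq0.
pose n := maxn (size A) (size B).
have szA : (size A <= n.+1)%N by rewrite leqW // leq_maxl.
have szB : (size B <= n.+1)%N by rewrite leqW // leq_maxr.
rewrite (evinf_px szA) (evinf_px szB) => e.
have : px (reverse_poly n A * 'X^3) + px (reverse_poly n B) * y = 0.
  have xn0 : x ^+ n != 0 by rewrite expf_neq0.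
  transitivity ((px (reverse_poly n A) / x ^+ n + px (reverse_poly n B) / x ^+ n * (y / x ^+ 3))
                * (x ^+ n * x ^+ 3)); last by rewrite e mul0r.
  by rewrite rmorphM rmorphXn /= pxX; field; rewrite xn0 x0.
case/px_indep => /eqP; rewrite mulf_eq0 expf_eq0 polyX_eq0 orbF => /eqP rA rB.
by rewrite (reverse_poly_eq0 szA rA) (reverse_poly_eq0 szB rB).
Qed.

Lemma inf_gen (f : K) : exists A B C : {poly k}, C != 0 /\
  f * evinf C = evinf A + evinf B * (y / x ^+ 3).
Proof.
have x0 := x_neq0.
have [A [B [C [C0 E]]]] := m_gen M f.
pose n := maxn (size A) (maxn (size (B * 'X^3)) (size C)).
have szA : (size A <= n.+1)%N by rewrite leqW // leq_maxl.
have szB : (size (B * 'X^3)%R <= n.+1)%N by rewrite leqW // leq_max leq_maxl orbT.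
have szC : (size C <= n.+1)%N by rewrite leqW // leq_max leq_maxr orbT.
exists (reverse_poly n A), (reverse_poly n (B * 'X^3)), (reverse_poly n C); split.
  by apply: contraNneq C0 => /(reverse_poly_eq0 szC) ->.
rewrite !evinf_reverse // rmorphM rmorphXn /= mulrA E mulrDl; congr (_ + _).
have xn0 : x ^+ n != 0 by rewrite expf_neq0.
by rewrite -/(px B) pxX; field; rewrite xn0 x0.
Qed.

Lemma inf_derivation : derivation (fun f : K => th f / x).
Proof.
split=> f h; first by rewrite (theta_deriv M).1 mulrDl.
by rewrite (theta_deriv M).2 mulrDl; congr (_ + _); rewrite ?mulrA // mulrAC.
Qed.

Lemma inf_deriv_const a : th (c a) / x = 0.
Proof. by rewrite theta_cst mul0r. Qed.

Lemma inf_deriv_X : th x^-1 / x = c (-1) * (y / x ^+ 3).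
Proof.
have x0 := x_neq0.
rewrite rmorphN rmorph1 -div1r (derivation_div (theta_deriv M)) //.
rewrite (derivation1 (theta_deriv M)) theta_mx.
by field.
Qed.

Lemma minus1_neq0 : -1 != 0 :> k.
Proof. by rewrite oppr_eq0 oner_neq0. Qed.

(** theta and x have poles of the same order at infinity, and theta / x is
    a regular vector field that does not vanish there. *)
Definition chart_inf : curve_chart c :=
  @CurveChart _ _ c _ _ Ginf 0 0 (fun f => th f / x) (-1) two0 Ginf_eq Ginf0
    (fun _ => Ginf_smooth) inf_indep inf_gen
    inf_derivation inf_deriv_const minus1_neq0 inf_deriv_X.

Definition point_chart (P : point g) : curve_chart c :=
  if P is Some Q then chart_affine (eqP (valP Q)) else chart_inf.

Definition affine_point (a b : k) (e : b ^+ 2 == g.[a]) : point g := Some (exist _ (a, b) e).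

Local Notation value_at P := (has_value (point_chart P)).
Local Notation order_at P := (has_order (point_chart P)).

Lemma value_at_px (Q : {P : k * k | P.2 ^+ 2 == g.[P.1]}) A :
  value_at (Some Q) (px A) A.[(val Q).1].
Proof. exact: (has_value_ev (point_chart (Some Q))). Qed.

Lemma value_at_y (Q : {P : k * k | P.2 ^+ 2 == g.[P.1]}) : value_at (Some Q) y (val Q).2.
Proof. exact: (has_valueY (point_chart (Some Q))). Qed.

Lemma value_inf_xV : value_at None x^-1 0.
Proof. exact: (has_valueX (point_chart None)). Qed.

Lemma order_inf_x : order_at None x (- 2).
Proof.
have := has_order_XsubC (point_chart None); rewrite /= eqxx rmorph0 subr0 => /has_orderV.
by rewrite invrK.
Qed.

Lemma order_inf_y : order_at None y (- 5).
Proof.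
have oY : order_at None (y / x ^+ 3) 1.
  by have := has_order_unif (point_chart None); rewrite /chart_unif /= eqxx.
have := has_orderM oY (has_orderX 3 order_inf_x).
by rewrite divfK ?expf_neq0 ?x_neq0.
Qed.

Lemma order_inf_px A : A != 0 -> order_at None (px A) (- 2 *+ (size A).-1).
Proof.
move=> A0; have szA : (size A <= (size A).-1.+1)%N by rewrite leqSpred.
have -> : px A = (map_poly c (reverse_poly (size A).-1 A)).[x^-1] * x ^+ (size A).-1.
  by rewrite (evinf_reverse szA) divfK // expf_neq0 // x_neq0.
rewrite -[X in order_at _ _ X]add0r; apply: has_orderM; last exact: has_orderX order_inf_x.
apply: (has_value_order0 (has_value_ev (point_chart None) _)).
by rewrite /= reverse_poly0 -lead_coefE lead_coef_eq0.
Qed.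

Definition opp_point (P : point g) : point g :=
  if P is Some Q then
    Some (exist (fun P : k * k => P.2 ^+ 2 == g.[P.1]) ((val Q).1, - (val Q).2)
            (eq_ind_r (fun z => z == g.[(val Q).1]) (valP Q) (sqrrN (val Q).2)))
  else None.

Lemma opp_pointK : involutive opp_point.
Proof.
by case=> [[[a b] e]|] //; congr Some; apply: val_inj; rewrite /= opprK.
Qed.

Lemma conj_px A : m_conj M (px A) = px A.
Proof.
elim/poly_ind: A => [|A a IH]; first by rewrite !rmorph0.
by rewrite !rmorphD !rmorphM /= pxX pxC IH conj_mx conj_cst.
Qed.

Lemma conj_value P f v : value_at P f v -> value_at (opp_point P) (m_conj M f) v.
Proof.
have C h w : coord_value (point_chart P) h w ->
    coord_value (point_chart (opp_point P)) (m_conj M h) w.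
  move=> [A [B [-> ->]]]; exists A, (- B); case: P A B => [Q|] A B; rewrite /ev /=.
    rewrite !rmorphD !rmorphM /= !conj_px conj_my rmorphN hornerN.
    by split; [rewrite mulrN mulNr|rewrite hornerN mulrNN].
  split; last by rewrite !mulr0.
  have E D : m_conj M ((map_poly c D).[x^-1]) = (map_poly c D).[x^-1].
    elim/poly_ind: D => [|D a IH]; first by rewrite rmorph0 hornerC rmorph0.
    rewrite rmorphD rmorphM /= map_polyX map_polyC /= !hornerE.
    by rewrite rmorphD rmorphM /= IH fmorphV conj_mx conj_cst.
  rewrite rmorphD rmorphM /= !E fmorph_div rmorphXn conj_mx conj_my.
  by rewrite rmorphN hornerN mulNr mulNr mulrN.
move=> [n [e [nv [w [n1 e1 w0 fE ->]]]]].
exists (m_conj M n), (m_conj M e), nv, w; split; [exact: C|exact: C|by []| |by []].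
by rewrite -rmorphM fE.
Qed.

Lemma conj_unif P : exists2 s : k, s != 0 &
  m_conj M (chart_unif (point_chart P)) = c s * chart_unif (point_chart (opp_point P)).
Proof.
case: P => [Q|]; rewrite /chart_unif /=.
  rewrite oppr_eq0; case: ifP => _.
    exists (-1); first by rewrite oppr_eq0 oner_eq0.
    by rewrite conj_my rmorphN1 mulN1r.
  exists 1; first exact: oner_neq0.
  by rewrite rmorphB conj_mx conj_cst rmorph1 mul1r.
exists (-1); first by rewrite oppr_eq0 oner_eq0.
by rewrite eqxx fmorph_div rmorphXn conj_mx conj_my rmorphN1 mulN1r mulNr.
Qed.

Lemma conj_order P f n : order_at P f n -> order_at (opp_point P) (m_conj M f) n.
Proof.
move=> [e [v [v0 ev ->]]]; have [s s0 us] := conj_unif P.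
exists (c (s ^ n) * m_conj M e), (s ^ n * v).
rewrite mulf_neq0 ?expfz_neq0 //; split=> //.
  by apply: has_valueM (has_valueC _ _) (conj_value ev).
by rewrite rmorphM /= fmorphXz us expfzMl fmorphXz; ring.
Qed.

End Model.

(** * Regular functions and divisors of functions *)

Lemma pth_root (k : closedFieldType) p (a : k) : (0 < p)%N -> exists b, b ^+ p = a.
Proof.
move=> p0; have [b bE] := @solve_monicpoly k p (fun i => if i == 0%N then a else 0) p0.
exists b; rewrite bE; case: p p0 {bE} => // n _.
by rewrite big_ord_recl big1 ?addr0 ?mulr1 // => i _; rewrite mul0r.
Qed.

Section Divisors.
Variables (k : closedFieldType) (g : quintic k) (K : fieldType) (M : curve_model g K).
Hypothesis two0 : 2 != 0 :> k.
Hypothesis C_smooth : affine_smooth g.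
Local Notation c := (m_cst M).
Local Notation x := (mx M).
Local Notation y := (my M).
Local Notation px := (px M).
Local Notation ch P := (point_chart M two0 C_smooth P).
Local Notation value_at P := (has_value (ch P)).
Local Notation order_at P := (has_order (ch P)).
Local Notation pt Q := (Some Q : point g).

Lemma point_above (a : k) : exists b, b ^+ 2 == g.[a].
Proof.
by have [b bE] := pth_root g.[a] (isT : (0 < 2)%N); exists b; rewrite bE.
Qed.

Lemma frac_coprime (f : K) (C n : {poly k}) : C != 0 -> f * px C = px n ->
  exists n' d, [/\ d != 0, coprimep n' d & f * px d = px n'].
Proof.
move=> C0 E; pose e := gcdp n C.
have e0 : e != 0 by rewrite gcdp_eq0 (negPf C0) andbF.
exists (n %/ e), (C %/ e); split.
- by rewrite dvdp_div_eq0 ?dvdp_gcdr.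
- by rewrite coprimep_div_gcd // C0 orbT.
apply: (@mulIf _ (px e)); first by rewrite px_eq0.
by rewrite -mulrA -!rmorphM !divpK ?dvdp_gcdl ?dvdp_gcdr.
Qed.

Definition regular_affine (f : K) := forall Q, exists v, value_at (pt Q) f v.

(** A root of the reduced denominator gives a pole at the points above it. *)
Lemma regular_rational (f : K) (C n : {poly k}) : C != 0 -> f * px C = px n ->
  regular_affine f -> exists A, f = px A.
Proof.
move=> C0 E reg; have [n' [d [d0 cop fE]]] := frac_coprime C0 E.
have [sz1|/closed_rootP [a ra]] := boolP (size d == 1).
  have [e e0 dE] := size_poly1P d sz1.
  exists (e^-1 *: n'); rewrite -mul_polyC rmorphM /= pxC -fE dE pxC mulrCA -rmorphM /=.
  by rewrite mulVf // rmorph1 mulr1.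
have [b be] := point_above a.
pose Q : {P : k * k | P.2 ^+ 2 == g.[P.1]} := exist _ (a, b) be.
have [v fv] := reg Q; have := has_valueM fv (value_at_px M two0 C_smooth Q d).
rewrite fE => /(has_value_fun (value_at_px M two0 C_smooth Q n')) /=.
rewrite (rootP ra) mulr0 => na.
by have := coprimep_root cop (introT rootP na); rewrite (rootP ra) eqxx.
Qed.

Lemma regular_conj (f : K) : regular_affine f -> regular_affine (m_conj M f).
Proof.
move=> reg Q; case E: (opp_point (pt Q)) => [Q'|] //; have [v fv] := reg Q'.
by exists v; have := conj_value fv; rewrite -E opp_pointK.
Qed.

Lemma two_model_neq0 : 2 != 0 :> K.
Proof. by rewrite -(rmorph_nat c) fmorph_eq0. Qed.

(** Separate the even and the odd part under y -> -y. The even part is a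
    rational function of x. The odd part is b y with b^2 g a polynomial, and g is
    squarefree because the curve is smooth, so b is a polynomial. *)
Lemma regular_affine_poly (f : K) : regular_affine f ->
  exists A B, f = px A + px B * y.
Proof.
move=> reg; have [A [B [C [C0 E]]]] := m_gen M f.
have {}E : f * px C = px A + px B * y := E.
have Ec : m_conj M f * px C = px A - px B * y.
  by rewrite -(conj_px M C) -rmorphM E rmorphD rmorphM /= !conj_px conj_my mulrN.
have reg' := regular_conj reg.
have [A' AE] : exists A', f + m_conj M f = px A'.
  apply: (@regular_rational _ C (A + A)) => //.
    by rewrite mulrDl E Ec rmorphD; ring.
  by move=> Q; have [v fv] := reg Q; have [w fw] := reg' Q; exists (v + w); exact: has_valueD.
have C0' : px C != 0 by rewrite px_eq0.
have dE : f - m_conj M f = px (B + B) * y / px C.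
  by apply: (mulIf C0'); rewrite divfK // mulrBl E Ec rmorphD; ring.
have [D DE] : exists D, (f - m_conj M f) ^+ 2 = px D.
  apply: (@regular_rational _ (C ^+ 2) ((B + B) ^+ 2 * g)).
  - by rewrite expf_neq0.
  - by rewrite dE (rmorphM px (_ ^+ 2)) !(rmorphXn px) /= -yE; field.
  move=> Q; have [v fv] := reg Q; have [w fw] := reg' Q; exists ((v - w) ^+ 2).
  by apply: has_valueXn; exact: has_valueB.
have E1 : (f - m_conj M f) / y * px C = px (B + B).
  by rewrite dE; field; rewrite C0' y_neq0.
have [n [d [d0 cop nE]]] := frac_coprime C0 E1.
have y0 := y_neq0 M.
have gE : n ^+ 2 * g = D * d ^+ 2.
  apply: (@px_inj _ _ _ M); rewrite (rmorphM px (_ ^+ 2)) (rmorphM px _ (d ^+ 2)).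
  rewrite !(rmorphXn px) /= -DE -nE -yE.
  by field.
have sz1 : size d == 1.
  apply/negPn/negP => /closed_rootP [a ra].
  have : d ^+ 2 %| g.
    have cop2 : coprimep (d ^+ 2) (n ^+ 2).
      by rewrite coprimep_expl // coprimep_expr // coprimep_sym.
    by rewrite -(Gauss_dvdpr g cop2) gE dvdp_mull.
  move=> /(dvdp_trans (dvdp_exp2r 2 (etrans (dvdp_XsubCl d a) ra))) /dvdpP [q].
  have := hornerXsubC a a; rewrite subrr; move: ('X - a%:P) => P Pa gq.
  have ga : g.[a] = 0 by rewrite gq hornerM horner_exp Pa expr0n mulr0.
  have [] := C_smooth (a := a) (b := 0); first by rewrite ga expr0n.
    by rewrite mul0rn eqxx.
  by rewrite gq derivM expr2 derivM !hornerE Pa /= !(mulr0, mul0r, addr0) eqxx.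
have [e e0 de] := size_poly1P d sz1.
have t0 := two_model_neq0; have ce0 : c e != 0 by rewrite fmorph_eq0.
exists (2^-1 *: A'), ((e^-1 / 2) *: n).
rewrite -!mul_polyC !rmorphM /= !pxC -AE -nE de pxC !fmorphV rmorph_nat.
by field; rewrite t0 ce0 y0.
Qed.

(** The pole of f at infinity has order at most 2, and so have those of its
    even and odd parts. A polynomial of degree n in x has a pole of order 2 n, and
    y one of order 5. In terms of forms, this determines the f for which f dx / y
    has no poles. *)
Lemma regular_twist (f : K) : regular_affine f -> (exists v, value_at None (f / x) v) ->
  exists u v, f = c u + c v * x.
Proof.
move=> reg [w fw]; have [A [B fE]] := regular_affine_poly reg.
have x0 := x_neq0 M; have t0 := two_model_neq0.
have cfE : m_conj M f = px A - px B * y.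
  by rewrite fE rmorphD rmorphM /= !conj_px conj_my mulrN.
have fw' := conj_value fw; rewrite /= fmorph_div conj_mx cfE in fw'.
rewrite fE in fw.
have lA : exists v, value_at None (px A / x) v.
  exists (2^-1 * (w + w)).
  have -> : px A / x = c (2^-1) * ((px A + px B * y) / x + (px A - px B * y) / x).
    by rewrite fmorphV rmorph_nat; field; rewrite t0 x0.
  by apply: has_valueM (has_valueC _ _) (has_valueD fw fw').
have lB : exists v, value_at None (px B * y / x) v.
  exists (2^-1 * (w - w)).
  have -> : px B * y / x = c (2^-1) * ((px A + px B * y) / x - (px A - px B * y) / x).
    by rewrite fmorphV rmorph_nat; field; rewrite t0 x0.
  by apply: has_valueM (has_valueC _ _) (has_valueB fw fw').
have B0 : B = 0.
  apply/eqP/negPn/negP => B0; have [v lv] := lB.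
  have := has_value_order_ge0 lv (has_order_div (has_orderM (order_inf_px M two0 C_smooth B0)
     (order_inf_y M two0 C_smooth)) (order_inf_x M two0 C_smooth)).
  lia.
have szA : (size A <= 2)%N.
  have [->|A0] := eqVneq A 0; first by rewrite size_poly0.
  have [v lv] := lA.
  have := has_value_order_ge0 lv (has_order_div (order_inf_px M two0 C_smooth A0)
     (order_inf_x M two0 C_smooth)).
  lia.
exists A`_0, A`_1; rewrite fE B0 rmorph0 mul0r addr0.
have {1}-> : A = (A`_0)%:P + (A`_1)%:P * 'X.
  apply/polyP => i; rewrite coefD coefC coefCM coefX.
  case: i => [|[|i]]; rewrite ?mulr0 ?addr0 ?mulr1 ?add0r //.
  by rewrite nth_default // (leq_trans szA).
by rewrite rmorphD rmorphM /= !pxC pxX.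
Qed.

Lemma regular_const (f : K) : (forall P, exists v, value_at P f v) -> exists u, f = c u.
Proof.
move=> reg; have [w fw] := reg None; have x0 := x_neq0 M.
have lx := value_inf_xV M two0 C_smooth.
have [||u [v fE]] := @regular_twist f; first by move=> Q; exact: reg.
  by exists (w * 0); exact: has_valueM fw lx.
exists u; have := has_valueM fw lx; rewrite fE mulr0 => l0.
have : value_at None ((c u + c v * x) / x) (u * 0 + v).
  have -> : (c u + c v * x) / x = c u * x^-1 + c v by field.
  by apply: has_valueD (has_valueC _ _); apply: has_valueM lx; exact: has_valueC.
by move/(has_value_fun l0); rewrite mulr0 add0r => <-; rewrite rmorph0 mul0r addr0.
Qed.

Definition has_divisor (f : K) (D : divisor g) : Prop := forall P, order_at P f (coeff P D).

Lemma has_divisorM f h D E : has_divisor f D -> has_divisor h E -> has_divisor (f * h) (D + E).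
Proof. by move=> fD hE P; rewrite coeffD; exact: has_orderM. Qed.

Lemma has_divisor_div f h D E : has_divisor f D -> has_divisor h E -> has_divisor (f / h) (D - E).
Proof. by move=> fD hE P; rewrite coeffB; exact: has_order_div. Qed.

Lemma has_divisor_const a : a != 0 -> has_divisor (c a) 0.
Proof. by move=> a0 P; rewrite coeff0; apply: has_value_order0 (has_valueC _ _) a0. Qed.

Lemma has_divisor_uniq f D E : has_divisor f D -> has_divisor f E -> D = E.
Proof.
by move=> fD fE; apply/eqP/freeg_eqP => P; exact: has_order_fun (fD P) (fE P).
Qed.

Lemma has_divisorX f D n : has_divisor f D -> has_divisor (f ^+ n) (D *+ n).
Proof. by move=> fD P; rewrite coeffMn; exact: has_orderX. Qed.

(** The two points above a coincide when b = 0. *)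
Lemma has_divisor_vertical a (b : k) (be : b ^+ 2 == g.[a]) (P := affine_point be) :
  has_divisor (x - c a) (<< P >> + << opp_point P >> - << 2 *g None >>).
Proof.
have xE : x - c a = px ('X - a%:P) by rewrite rmorphB /= pxX pxC.
move=> R; rewrite coeffB coeffD !coeffU; case: R => [Q|]; last first.
  rewrite /= !mulr0 !add0r mulr1 xE.
  have X0 : 'X - a%:P != 0 :> {poly k} by rewrite polyXsubC_eq0.
  have := order_inf_px M two0 C_smooth X0; rewrite size_XsubC /=.
  by rewrite mulr1n.
have -> : (None == Some Q :> point g) = false by [].
rewrite mulr0 subr0 !mul1r.
have -> : (P == Some Q) = (a == (val Q).1) && (b == (val Q).2).
  by rewrite /P /affine_point -[LHS]/(_ == Q) -val_eqE /= -pair_eqE; case: (val Q).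
have -> : (opp_point P == Some Q) = (a == (val Q).1) && (- b == (val Q).2).
  by rewrite /P /affine_point -[LHS]/(_ == Q) -val_eqE /= -pair_eqE; case: (val Q).
have [ea|na] := eqVneq a (val Q).1; last first.
  have := value_at_px M two0 C_smooth Q ('X - a%:P); rewrite hornerXsubC -xE => l.
  by rewrite addr0; apply: has_value_order0 l _; rewrite subr_eq0 eq_sym.
have -> : x - c a = x - c (val Q).1 by rewrite ea.
suff -> : (b == (val Q).2)%:R + (- b == (val Q).2)%:R =
    (if (val Q).2 == 0 :> k then 2%:Z else 1%:Z) by exact: (has_order_XsubC (ch (Some Q))).
have : (b == (val Q).2) || (- b == (val Q).2).
  by rewrite eqr_oppLR -eqf_sqr (eqP (valP Q)) (eqP be) ea.
have bb : (b == - b) = (b == 0).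
  by rewrite -subr_eq0 opprK -mulr2n -mulr_natl mulf_eq0 (negPf two0).
case/orP => /eqP <-; rewrite eqxx.
  by rewrite [- b == b]eq_sym bb; case: eqP.
by rewrite oppr_eq0 bb; case: eqP.
Qed.

Lemma opp_point_inj : injective (@opp_point k g).
Proof. exact: inv_inj (@opp_pointK k g). Qed.

Lemma has_divisor_px A : A != 0 -> exists2 D, has_divisor (px A) D & deg D = 0.
Proof.
move=> A0; have [r ->] := closed_field_poly_normal A.
have lc0 : lead_coef A != 0 by rewrite lead_coef_eq0.
rewrite -mul_polyC rmorphM /= pxC.
suff [D rD D0] : exists2 D, has_divisor (px (\prod_(z <- r) ('X - z%:P))) D & deg D = 0.
  by exists (0 + D); [apply: has_divisorM rD; exact: has_divisor_const|rewrite add0r].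
elim: r {A A0 lc0} => [|a r [D rD D0]].
  by exists 0; rewrite ?deg0 // big_nil rmorph1 -(rmorph1 c); apply/has_divisor_const/oner_neq0.
have [b be] := point_above a.
rewrite big_cons rmorphM /= rmorphB /= pxX pxC; eexists.
  by apply: has_divisorM rD; exact: (has_divisor_vertical be).
by rewrite degD D0 degB degD !degU.
Qed.

(** The norm of A + B y is a polynomial in x, and its roots lie below all
    affine zeros of A + B y, so these are finite in number. The involution
    preserves degrees, so the divisor of the norm, which has degree zero, has twice
    the degree of that of A + B y. *)
Lemma has_divisor_polynomial A B : px A + px B * y != 0 ->
  exists2 D, has_divisor (px A + px B * y) D & deg D = 0.
Proof.
set F := _ + _ => F0; pose N := A ^+ 2 - B ^+ 2 * g.
have cF : m_conj M F = px A - px B * y.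
  by rewrite rmorphD rmorphM /= !conj_px conj_my mulrN.
have NE : F * m_conj M F = px N.
  by rewrite cF /F /N rmorphB (rmorphM px _ g) !(rmorphXn px) /= -yE; ring.
have N0 : N != 0 by rewrite -(px_eq0 M) -NE mulf_neq0 // fmorph_eq0.
have [r rE] := closed_field_poly_normal N.
have [pts ptsE] : exists pts : seq (point g), forall Q, (val Q).1 \in r -> pt Q \in pts.
  elim: r {rE} => [|a r [pts IH]]; first by exists [::].
  have [b be] := point_above a; pose P := affine_point be.
  exists (P :: opp_point P :: pts) => Q; rewrite !inE.
  move=> /orP [/eqP ea|/IH ->]; last by rewrite !orbT.
  have : (b == (val Q).2) || (- b == (val Q).2).
    by rewrite eqr_oppLR -eqf_sqr (eqP (valP Q)) (eqP be) ea.
  rewrite /P /affine_point; case/orP => /eqP eb; apply/orP; [left|right; apply/orP; left].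
    by apply/eqP; congr Some; apply: val_inj; rewrite /= eb -ea; exact: surjective_pairing.
  by apply/eqP; congr Some; apply: val_inj; rewrite /= eb -ea; exact: surjective_pairing.
pose S := undup (None :: pts).
have ordF P : {n | order_at P F n} by apply: cid; exact: has_order_exists.
pose n P := sval (ordF P).
have nP P : order_at P F (n P) := svalP (ordF P).
have nS P : P \notin S -> n P = 0.
  rewrite mem_undup inE negb_or => /andP [].
  case: P => [Q|] // _ /(contra (@ptsE Q)) rQ.
  have lF : value_at (pt Q) F (A.[(val Q).1] + B.[(val Q).1] * (val Q).2).
    apply: has_valueD (value_at_px _ _ _ _ _) _.
    exact: has_valueM (value_at_px _ _ _ _ _) (value_at_y _ _ _ _).
  apply: has_order_fun (nP _) (has_value_order0 lF _).
  apply: contra rQ => /eqP e0.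
  have : root N (val Q).1.
    rewrite /root /N hornerD hornerN (hornerM (B ^+ 2)) !horner_exp -(eqP (valP Q)).
    have -> : A.[(val Q).1] = - (B.[(val Q).1] * (val Q).2) by apply/eqP; rewrite -addr_eq0 e0.
    by apply/eqP; ring.
  by rewrite rE rootZ ?lead_coef_eq0 // root_prod_XsubC.
pose D : divisor g := \sum_(R <- S) << n R *g R >>.
(* D' is the image of D under the involution, hence the divisor of the
   conjugate of F, and D + D' is the divisor of the norm of F. *)
pose D' : divisor g := \sum_(R <- S) << n R *g opp_point R >>.
have coefD P : coeff P D = n P.
  rewrite /D (raddf_sum (coeff P)) /=; under eq_bigr => R _ do rewrite coeffU.
  have [PS|PS] := boolP (P \in S).
    rewrite (bigD1_seq P) ?undup_uniq //= eqxx mulr1 big1 ?addr0 // => R /negPf ->.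
    by rewrite mulr0.
  rewrite nS // big_seq big1 // => R RS; case: eqP => [RP|_]; last by rewrite mulr0.
  by rewrite -RP RS in PS.
have coefD' P : coeff P D' = coeff (opp_point P) D.
  rewrite /D /D' !(raddf_sum (coeff _)) /=; apply: eq_bigr => R _; rewrite !coeffU.
  by rewrite -(inj_eq opp_point_inj) opp_pointK.
have FD : has_divisor F D by move=> P; rewrite coefD.
have FD' : has_divisor (m_conj M F) D'.
  by move=> P; rewrite coefD' coefD -{1}(opp_pointK P); exact: conj_order.
have degDD : deg D' = deg D.
  by rewrite /D /D' !raddf_sum /=; apply: eq_bigr => R _; rewrite !degU.
have [E NE' E0] := has_divisor_px N0.
exists D => //.
have : deg (D + D') = 0.
  by rewrite (has_divisor_uniq (has_divisorM FD FD') (_ : has_divisor (F * m_conj M F) E)) // NE.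
rewrite degD degDD; lia.
Qed.

Lemma has_divisor_exists f : f != 0 -> exists2 D, has_divisor f D & deg D = 0.
Proof.
move=> f0; have [A [B [C [C0 E]]]] := m_gen M f.
have C0' : px C != 0 by rewrite px_eq0.
have {}E : f * px C = px A + px B * y := E.
have g0 : px A + px B * y != 0 by rewrite -E mulf_neq0.
have [D FD D0] := has_divisor_polynomial g0; have [D' CD D0'] := has_divisor_px C0.
exists (D - D'); last by rewrite degB D0 D0'.
by rewrite -[f](mulfK C0') E; exact: has_divisor_div.
Qed.

End Divisors.

(** * The derivation theta and the polynomial g_p *)

(** theta^2 raises degrees in x by 3. *)
Lemma size_theta_even (k : fieldType) (g : quintic k) n :
  (size (theta_even g n) <= 3 * n + 2)%N.
Proof.
elim: n => [|n IH]; first by rewrite size_polyX.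
set q := theta_even g n in IH *.
have szd (A : {poly k}) m : (size A <= m.+1)%N -> (size A^`() <= m)%N.
  by move=> szA; rewrite /deriv (leq_trans (size_poly _ _)) // -subn1 leq_subLR add1n.
have szM (A B : {poly k}) m l : (size A <= m)%N -> (size B <= l)%N ->
    (size (A * B)%R <= (m + l).-1)%N.
  move=> szA szB; apply: leq_trans (size_polyMleq _ _) _.
  by rewrite -!subn1 leq_sub2r // leq_add.
have sd1 : (size q^`() <= (3 * n).+1)%N by apply: szd; rewrite -addn2.
have sd2 : (size q^`()^`() <= 3 * n)%N by apply: szd.
have sg1 : (size g^`() <= 5)%N by apply: szd; rewrite size_quintic.
rewrite /= -/q (leq_trans (size_polyD _ _)) // geq_max; apply/andP; split.
  apply: leq_trans (szM _ _ _ 6 sd2 _) _; rewrite ?size_quintic //; lia.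
apply: leq_trans (size_scale_leq _ _) _.
by apply: leq_trans (szM _ _ _ _ sd1 sg1) _; lia.
Qed.

Lemma coef_deriv0_pchar (k : fieldType) p (hp : p \in [pchar k]) (A : {poly k}) i :
  A^`()`_i.-1 = 0 -> ~~ (p %| i)%N -> A`_i = 0.
Proof.
case: i => [|i]; first by rewrite dvdn0.
rewrite coef_deriv -mulr_natr => /eqP; rewrite mulf_eq0 => /orP [/eqP //|].
by rewrite -(dvdn_pcharf hp) => ->.
Qed.

(** A zero second derivative leaves the degrees that are 0 or 1 modulo p, and
    there are four of those below 2 p. *)
Lemma poly_deriv2_pchar (k : fieldType) p (hp : p \in [pchar k]) (A : {poly k}) :
  A^`()^`() = 0 -> (size A <= p.*2)%N ->
  A = (A`_0)%:P + (A`_1)%:P * 'X + (A`_p)%:P * 'X^p + (A`_p.+1)%:P * 'X^(p.+1).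
Proof.
move=> d2 szA; have p1 := prime_gt1 (pcharf_prime hp).
apply/polyP => i; rewrite !(coefD, coefCM, coefC, coefX, coefXn).
have [->|i0] := eqVneq i 0%N.
  by rewrite (ltn_eqF (ltnW p1)) /= !(mulr0, addr0).
have [->|i1] := eqVneq i 1%N.
  by rewrite (ltn_eqF p1) (ltn_eqF (ltnW p1 : 1 < p.+1)%N) /= !(mulr0, addr0, add0r, mulr1).
have [->|ip] := eqVneq i p.
  by rewrite (ltn_eqF (ltnSn p)) /= !(mulr0, addr0, add0r, mulr1).
have [->|ip1] := eqVneq i p.+1.
  by rewrite /= !(mulr0, addr0, add0r, mulr1).
rewrite /= !(mulr0, addr0).
have [lt_i|le_i] := ltnP i p.*2; last by rewrite nth_default // (leq_trans szA).
have ndvd j : (0 < j)%N -> j != p -> (j < p.*2)%N -> ~~ (p %| j)%N.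
  move=> j0 jp jp2; apply/negP => /dvdnP [q jE]; move: j0 jp jp2; rewrite jE.
  by case: q {jE} => [|[|q]] //; rewrite ?mul1n ?eqxx //; lia.
apply: (coef_deriv0_pchar hp); last by apply: ndvd => //; lia.
apply: (coef_deriv0_pchar hp); first by rewrite d2 coef0.
by apply: ndvd; lia.
Qed.

Lemma deriv0_pth_power (k : closedFieldType) p (hp : p \in [pchar k]) (A : {poly k}) :
  A^`() = 0 -> exists B, A = B ^+ p.
Proof.
move=> d0; have p0 := prime_gt0 (pcharf_prime hp).
have hP : p \in [pchar {poly k}] by rewrite pchar_poly.
rewrite -[A]coefK poly_def.
apply: (big_ind (fun F : {poly k} => exists B, F = B ^+ p)).
- by exists 0; rewrite expr0n eqn0Ngt p0.
- by move=> _ _ [B ->] [B' ->]; exists (B + B'); rewrite -!(pFrobenius_autE hP) rmorphD.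
move=> i _; have [/dvdnP [j ->]|nd] := boolP (p %| i)%N.
  have [b <-] := pth_root A`_(j * p) p0; exists (b *: 'X^j).
  by rewrite exprZn exprM.
exists 0; rewrite (coef_deriv0_pchar hp _ nd) ?d0 ?coef0 // scale0r.
by rewrite expr0n eqn0Ngt p0.
Qed.

Section Theta.
Variables (k : closedFieldType) (g : quintic k) (K : fieldType) (M : curve_model g K).
Variables (p : nat) (hp : p \in [pchar k]) (p_gt2 : (2 < p)%N).
Local Notation c := (m_cst M).
Local Notation x := (mx M).
Local Notation y := (my M).
Local Notation px := (px M).
Local Notation th := (m_theta M).
Let dth := theta_deriv M.

Lemma two_pchar : 2 != 0 :> k.
Proof. by rewrite -(dvdn_pcharf hp) gtnNdvd. Qed.

Lemma pchar_model : p \in [pchar K].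
Proof. by rewrite (fmorph_pchar c). Qed.

Lemma theta_px A : th (px A) = y * px A^`().
Proof.
elim/poly_ind: A => [|A a IH]; first by rewrite derivC !rmorph0 (derivation0 dth) mulr0.
rewrite derivMXaddC !rmorphD /= !rmorphM /= pxX pxC.
by rewrite dth.1 dth.2 IH theta_mx theta_cst; ring.
Qed.

(** K is separable over k(x), as y^2 = g(x) and 2 is invertible. *)
Lemma derivation_eq0 (D : K -> K) : derivation D -> (forall a, D (c a) = 0) ->
  D x = 0 -> forall f, D f = 0.
Proof.
move=> dD Dc Dx.
have Dpx A : D (px A) = 0.
  elim/poly_ind: A => [|A a IH]; first by rewrite rmorph0 (derivation0 dD).
  by rewrite rmorphD rmorphM /= pxX pxC dD.1 dD.2 IH Dx Dc; ring.
have t0 : 2 * y != 0 by rewrite mulf_neq0 ?y_neq0 // (two_model_neq0 M two_pchar).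
have Dy : D y = 0.
  apply: (mulfI t0); rewrite mulr0 -[RHS](Dpx g) -yE expr2 dD.2; ring.
move=> f; have [A [B [C [C0 E]]]] := m_gen M f.
have C0' : px C != 0 by rewrite px_eq0.
have {}E : f * px C = px A + px B * y := E.
apply: (mulIf C0'); rewrite mul0r.
have := dD.2 f (px C); rewrite E dD.1 dD.2 !Dpx Dy !(mul0r, mulr0, addr0).
by [].
Qed.

Variables (gp : {poly k}) (gpE : px gp = iter p.-1 th x).

Let hK := pchar_model.
Let p0 : (0 < p)%N. Proof. exact: ltn_trans p_gt2. Qed.

Lemma iter_theta_cst n a f : iter n th (c a * f) = c a * iter n th f.
Proof.
elim: n => [|n IH] //=; by rewrite IH dth.2 theta_cst mul0r add0r.
Qed.

Lemma iter_theta_cst0 n a : (0 < n)%N -> iter n th (c a) = 0.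
Proof.
case: n => // n _; elim: n => [|n IH]; first exact: theta_cst.
by rewrite iterS IH (derivation0 dth).
Qed.

(** theta^p is a derivation, so it is determined by its value at x, which is
    theta (g_p(x)) = g_p'(x) y. *)
Lemma theta_pchar f : iter p th f = px gp^`() * th f.
Proof.
have Dp := derivation_iter_pchar dth hK.
apply/eqP; rewrite -subr_eq0; apply/eqP.
pose D f := iter p th f - px gp^`() * th f; rewrite -/(D f).
apply: derivation_eq0.
- split=> u v; rewrite /D; first by rewrite Dp.1 dth.1; ring.
  by rewrite Dp.2 dth.2; ring.
- by move=> a; rewrite /D theta_cst mulr0 subr0 iter_theta_cst0.
- by rewrite /D -(prednK p0) iterS -gpE theta_px theta_mx; ring.
Qed.

(** theta commutes with theta^p, which is g_p' theta. *)
Lemma theta_gp' : th (px gp^`()) = 0.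
Proof.
have e : iter p th (th x) = th (iter p th x) by rewrite -iterSr iterS.
move: e; rewrite !theta_pchar dth.2 theta_mx => /eqP.
rewrite -subr_eq0 opprD addrC -addrA addNr addr0 oppr_eq0 mulf_eq0.
by rewrite (negPf (y_neq0 M)) orbF => /eqP.
Qed.

Lemma gp_deriv2 : gp^`()^`() = 0.
Proof.
have := theta_gp'; rewrite theta_px => /eqP.
by rewrite mulf_eq0 (negPf (y_neq0 M)) /= px_eq0 => /eqP.
Qed.

Hypothesis szgp : (size gp <= p.*2)%N.
Local Notation h1 := (gp`_0).
Local Notation h2 := (gp`_1).
Local Notation h3 := (gp`_p).
Local Notation h4 := (gp`_p.+1).

(** The forms (u + v x) dx / y that are fixed by the Cartier operator. *)
Definition frob_sol (w : k * k) : Prop :=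
  w.1 ^+ p = h2 * w.1 - h1 * w.2 /\ w.2 ^+ p = h4 * w.1 - h3 * w.2.

(** The quotient of the form (u + v x) dx / y by dx / y. *)
Definition form (w : k * k) : K := c w.1 + c w.2 * x.

Lemma form_inj : injective form.
Proof.
move=> [u v] [u' v'] /= e.
have : px (u%:P + v%:P * 'X) = px (u'%:P + v'%:P * 'X).
  by rewrite !rmorphD !rmorphM /= !pxC pxX.
move/px_inj => e'.
have := congr1 (coefp 0) e'; have := congr1 (coefp 1) e'.
rewrite /coefp /= !(coefD, coefCM, coefC, coefX) /= !(mulr0, mulr1, addr0, add0r).
by move=> -> ->.
Qed.

(** Both sides are polynomials in x, which can differ only in degrees 0
    and p; these give the two equations. *)
Lemma frob_solE w :
  frob_sol w <-> iter p.-1 th (form w) + form w ^+ p = px gp^`() * form w.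
Proof.
case: w => u v; rewrite /frob_sol /form /=.
have gpS := poly_deriv2_pchar hp gp_deriv2 szgp.
have gp'S : gp^`() = h2%:P + h4%:P * 'X^p.
  rewrite {1}gpS !derivD !derivM !derivC !derivX !derivXn /=.
  have -> : 'X^p *+ p.+1 = 'X^p :> {poly k}.
    by rewrite mulrS -mulr_natr pcharf0 ?pchar_poly // mulr0 addr0.
  have -> : 'X^(p.-1) *+ p = 0 :> {poly k}.
    by rewrite -mulr_natr pcharf0 ?pchar_poly // mulr0.
  by ring.
have iterE : iter p.-1 th (c u + c v * x) = c v * px gp.
  rewrite (iter_derivationD dth) iter_theta_cst -gpE.
  by rewrite iter_theta_cst0 ?add0r // -ltnS (prednK p0) ltnW.
have powE : (c u + c v * x) ^+ p = c (u ^+ p) + c (v ^+ p) * x ^+ p.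
  by rewrite -!(pFrobenius_autE hK) rmorphD rmorphM /= !(pFrobenius_autE hK) -!rmorphXn.
rewrite iterE powE.
pose L := v%:P * gp + (u ^+ p)%:P + (v ^+ p)%:P * 'X^p.
pose R := gp^`() * (u%:P + v%:P * 'X).
have -> : c v * px gp + (c (u ^+ p) + c (v ^+ p) * x ^+ p) = px L.
  by rewrite /L !rmorphD !rmorphM /= !pxC (rmorphXn px) /= pxX addrA.
have -> : px gp^`() * (c u + c v * x) = px R.
  by rewrite /R rmorphM rmorphD rmorphM /= !pxC pxX.
have LR : L - R = (v * h1 + u ^+ p - h2 * u)%:P + (v * h3 + v ^+ p - h4 * u)%:P * 'X^p.
  rewrite /L /R gp'S {1}gpS exprS !(rmorphB, rmorphD, rmorphM) /=.
  by ring.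
split.
  move=> [e1 e2]; congr (px _); apply/eqP; rewrite -subr_eq0 LR e1 e2.
  by apply/eqP; rewrite !(rmorphB, rmorphD, rmorphM) /=; ring.
move=> /px_inj e; move: LR; rewrite e subrr => /esym LR.
have e0 := congr1 (coefp 0) LR; have ep := congr1 (coefp p) LR.
rewrite /coefp /= !(coefD, coefCM, coefC, coefXn, coef0) eqxx in e0 ep.
rewrite (ltn_eqF p0) /= mulr0 addr0 in e0.
rewrite (gtn_eqF p0) /= mulr1 add0r in ep.
split; apply/eqP; rewrite -subr_eq0; apply/eqP.
  by rewrite -[RHS]e0; ring.
by rewrite -[RHS]ep; ring.
Qed.

Lemma log_form_sol f w : f != 0 -> th f = form w * f -> frob_sol w.
Proof.
move=> f0 e; apply/frob_solE.
exact: (log_deriv_pchar dth hK theta_pchar f0 e).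
Qed.

Lemma log_form_exists w : frob_sol w -> exists2 f, f != 0 & th f = form w * f.
Proof.
move=> /frob_solE e.
have tx : th x != 0 by rewrite theta_mx y_neq0.
exact: (log_deriv_exists dth hK theta_pchar theta_gp' tx e).
Qed.

(** y^p is y times a power of g, so 1 and y^p form a basis of K over k(x).
    In this basis theta acts on the coordinates by y d/dx, and polynomials with
    zero derivative are p-th powers. *)
Lemma theta_kernel f : th f = 0 -> exists e, f = e ^+ p.
Proof.
move=> f0; have [A [B [C [C0 E]]]] := m_gen M f.
have {}E : f * px C = px A + px B * y := E.
have g0 : (g : {poly k}) != 0 by rewrite -size_poly_eq0 size_quintic.
have pg0 : px g != 0 by rewrite px_eq0.
have pC0 : px C != 0 by rewrite px_eq0.
have y0 := y_neq0 M.
have p_odd : odd p by case: (even_prime (pcharf_prime hp)) => // pE; move: (p_gt2); rewrite pE.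
have yp : y ^+ p = px g ^+ p./2 * y.
  by rewrite -{1}(odd_double_half p) p_odd exprD -mul2n exprM yE expr1 mulrC.
(* Multiply f by the p-th power of C g and rewrite y in terms of y^p, so that
   the derivation sees only two polynomials. *)
pose A1 := A * C ^+ p.-1 * (g : {poly k}) ^+ p.
pose B1 := B * C ^+ p.-1 * (g : {poly k}) ^+ (p - p./2).
have half_le : (p./2 <= p)%N by rewrite leq_half_double -addnn leqW // leq_addr.
have FE : f * px (C * (g : {poly k})) ^+ p = px A1 + px B1 * y ^+ p.
  have CE : px C ^+ p = px C * px C ^+ p.-1 by rewrite -exprS prednK.
  have GE : px g ^+ p = px g ^+ (p - p./2) * px g ^+ p./2 by rewrite -exprD subnK.
  rewrite yp /A1 /B1 !(rmorphM px) !(rmorphXn px) /= exprMn CE GE.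
  transitivity (f * px C * (px C ^+ p.-1 * (px g ^+ (p - p./2) * px g ^+ p./2))).
    by ring.
  by rewrite E; ring.
have thp h : th (h ^+ p) = 0 by rewrite (derivationX dth) (pcharf0 hK) !mul0r.
have : px A1^`() + px (B1^`() * (g : {poly k}) ^+ p./2) * y = 0.
  apply: (mulfI y0); rewrite mulr0 -[RHS](mul0r (px (C * (g : {poly k})) ^+ p)) -f0.
  transitivity (th (f * px (C * (g : {poly k})) ^+ p)); last by rewrite dth.2 thp mulr0 addr0.
  rewrite FE dth.1 dth.2 thp !theta_px yp rmorphM (rmorphXn px) /=.
  by ring.
case/px_indep => /(deriv0_pth_power hp) [a aE] /eqP.
rewrite mulf_eq0 expf_eq0 (negPf g0) andbF orbF => /eqP.
case/(deriv0_pth_power hp) => b bE.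
exists ((px a + px b * y) / px (C * (g : {poly k}))).
have Cg0 : px (C * (g : {poly k})) ^+ p != 0 by rewrite expf_neq0 // px_eq0 mulf_neq0.
rewrite expr_div_n; apply: (mulIf Cg0); rewrite divfK // FE aE bE !(rmorphXn px) /=.
by rewrite -!(pFrobenius_autE hK) -rmorphM -rmorphD.
Qed.

End Theta.

(** * Frobenius-linear systems in two unknowns *)

Lemma card_uniq_seq (T : choiceType) (A : set T) (s : seq T) :
  uniq s -> (forall z, A z <-> z \in s) -> (A #= `I_(size s))%card.
Proof.
move=> us As; have -> : A = [set` [fset z in s]%fset]%classic.
  by apply/seteqP; split=> z /=; rewrite in_fset /=; apply As.
by apply/card_eq_fsetP; rewrite card_fseq undup_id.
Qed.

Section Count.
Variables (k : closedFieldType) (p : nat) (hp : p \in [pchar k]).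

Definition solutions (T : eqType) (P : T -> Prop) (n : nat) : Prop :=
  exists s : seq T, [/\ uniq s, size s = n & forall z, P z <-> z \in s].

Let p1 : (1 < p)%N := prime_gt1 (pcharf_prime hp).
Let p0 : (0 < p)%N := ltnW p1.

Lemma frobD (u v : k) : (u + v) ^+ p = u ^+ p + v ^+ p.
Proof. by rewrite -!(pFrobenius_autE hp) rmorphD. Qed.

Lemma frobN (u : k) : (- u) ^+ p = - u ^+ p.
Proof. by rewrite -!(pFrobenius_autE hp) rmorphN. Qed.

Lemma frob_inj (u v : k) : u ^+ p = v ^+ p -> u = v.
Proof. by rewrite -!(pFrobenius_autE hp) => /fmorph_inj. Qed.

(** A nonzero constant derivative excludes repeated roots. *)
Lemma root_solutions (q : {poly k}) (e : k) :
  q^`() = e%:P -> e != 0 -> solutions (fun z => q.[z] = 0) (size q).-1.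
Proof.
move=> q' e0; have q0 : q != 0.
  by apply: contraNneq e0 => q0; move: q'; rewrite q0 derivC => /esym/eqP; rewrite polyC_eq0.
have [r rE] := closed_field_poly_normal q.
have lc0 : lead_coef q != 0 by rewrite lead_coef_eq0.
exists r; split.
- rewrite -separable_prod_XsubC -(eqp_separable (eqp_scale _ lc0)) -rE.
  by rewrite unlock q' -alg_polyC coprimepZr // coprimep1.
- by rewrite [in RHS]rE size_scale // size_prod_XsubC.
move=> z; rewrite -root_prod_XsubC -(rootZ _ _ lc0) -rE.
by split=> /rootP.
Qed.

Lemma additive_solutions (a : k) : a != 0 -> solutions (fun t => t ^+ p = a * t) p.
Proof.
move=> a0; pose q := 'X^p - a%:P * 'X.
have szq : size q = p.+1.
  rewrite size_polyDl size_polyXn // size_polyN size_Cmul ?size_polyX //.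
have [||s [us ss sP]] := @root_solutions q (- a).
- by rewrite derivB derivXn derivM derivC derivX -mulr_natr pcharf0 ?pchar_poly // polyCN; ring.
- by rewrite oppr_eq0.
exists s; split=> //; first by rewrite ss szq.
move=> z; rewrite -sP !hornerE; split=> [->|/eqP]; first by rewrite subrr.
by rewrite subr_eq0 => /eqP.
Qed.

Definition frob_sys (a b e f : k) (w : k * k) : Prop :=
  w.1 ^+ p = a * w.1 + b * w.2 /\ w.2 ^+ p = e * w.1 + f * w.2.

(** Express the second unknown by the first: what remains is an additive
    polynomial of degree p^2, whose linear coefficient is the determinant up to a
    nonzero factor. *)
Lemma frob_sys_elim a b e f : a * f - b * e != 0 -> b != 0 ->
  solutions (frob_sys a b e f) (p ^ 2).
Proof.
move=> det b0; pose v u := (u ^+ p - a * u) / b.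
pose q := (b ^- p)%:P * 'X^(p ^ 2) - (a ^+ p / b ^+ p + f / b)%:P * 'X^p
          + (a * f / b - e)%:P * 'X.
have qE u : q.[u] = v u ^+ p - (e * u + f * v u).
  rewrite /v expr_div_n frobD frobN exprMn !hornerE expnS expn1 exprM.
  by rewrite /=; field; rewrite expf_neq0 b0.
have szq : size q = (p ^ 2).+1.
  rewrite /q -addrA size_polyDl size_Cmul ?invr_eq0 ?expf_neq0 // size_polyXn //.
  rewrite ltnS (leq_trans (size_polyD _ _)) // geq_max size_polyN.
  rewrite !(leq_trans (size_polyMleq _ _)) //.
    rewrite size_polyX.
    by case: size (size_polyC_leq1 (a * f / b - e)) => [|[]] //= _; nia.
  rewrite size_polyXn.
  by case: size (size_polyC_leq1 (a ^+ p / b ^+ p + f / b)) => [|[]] //= _; nia.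
have [||s [us ss sP]] := @root_solutions q (a * f / b - e).
- have mulrp (A : {poly k}) : A *+ p = 0 by rewrite -mulr_natr pcharf0 ?pchar_poly // mulr0.
  by rewrite /q !(derivD, derivN, derivM, derivC, derivXn, derivX) -mulnn mulrnA !mulrp; ring.
- have -> : a * f / b - e = (a * f - b * e) / b by field.
  by rewrite mulf_neq0 ?invr_eq0.
exists [seq (u, v u) | u <- s]; split; last 1 first.
- move=> [u w]; split; last first.
    case/mapP => z; rewrite -sP qE => /eqP; rewrite subr_eq0 => /eqP e1 [-> ->].
    by split=> //=; rewrite /v; field.
  case=> /= e1 e2; have wE : w = v u by rewrite /v e1; field.
  by apply/mapP; exists u; rewrite -?sP ?qE -?wE ?e2 ?subrr.
- by rewrite map_inj_uniq // => z z' [].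
- by rewrite size_map ss szq.
Qed.

Lemma solutions_swap (P Q : k * k -> Prop) n :
  (forall u v, P (u, v) <-> Q (v, u)) -> solutions P n -> solutions Q n.
Proof.
move=> PQ [s [us ss sP]]; exists [seq (w.2, w.1) | w <- s]; split.
- by rewrite map_inj_uniq // => -[u v] [u' v'] /= [-> ->].
- by rewrite size_map.
move=> [v u]; rewrite -PQ sP; split=> [us'|/mapP [[u' v'] us' [-> ->]] //].
by apply/mapP; exists (u, v).
Qed.

Lemma frob_sys_regular a b e f : a * f - b * e != 0 ->
  solutions (frob_sys a b e f) (p ^ 2).
Proof.
move=> det; have [b0|b0] := eqVneq b 0; last exact: frob_sys_elim.
have [e0|e0] := eqVneq e 0.
  move: det; rewrite b0 mul0r subr0 mulf_eq0 negb_or => /andP [a0 f0].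
  have [s [us ss sP]] := additive_solutions a0.
  have [r [ur sr rP]] := additive_solutions f0.
  exists [seq (u, v) | u <- s, v <- r]; split.
  - by apply: allpairs_uniq => // -[? ?] [? ?].
  - by rewrite size_allpairs ss sr -mulnn.
  move=> [u v]; rewrite /frob_sys /= e0 !mul0r addr0 add0r.
  split=> [[/sP us' /rP vs]|/allpairsP [[u' v'] /= [/sP ? /rP ? [-> ->]]] //].
  by apply/allpairsP; exists (u, v).
apply: (@solutions_swap (frob_sys f e b a)).
  by move=> u v; rewrite /frob_sys /= [f * u + _]addrC [b * u + _]addrC; split=> -[].
by apply: frob_sys_elim => //; rewrite [f * a]mulrC [e * b]mulrC.
Qed.

(** Write the matrix as c_i d_j with c nonzero. The solutions are
    (g1 t, g2 t) with g_i^p = c_i and t^p = l t, where l = d1 g1 + d2 g2. The two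
    tested expressions are c2^(p-1) l^p and c1^p d1 l^p. If both are zero then
    l = 0, because l^p = c1 d1^p + c2 d2^p. *)
Lemma frob_sys_singular a b e f : a * f - b * e = 0 ->
  solutions (frob_sys a b e f)
    (if (f ^+ p + a * e ^+ p.-1 == 0) && (b ^+ p * e + a ^+ p.+1 == 0) then 1 else p).
Proof.
move=> det.
(* A singular matrix is a column c times a row d. *)
have [c1 [c2 [d1 [d2 [[aE bE eE fE] c0]]]]] : exists c1 c2 d1 d2 : k,
    [/\ a = c1 * d1, b = c1 * d2, e = c2 * d1 & f = c2 * d2] /\ (c1 != 0 \/ c2 != 0).
  have [a0|a0] := eqVneq a 0; last first.
    exists 1, (e / a), a, b; split; last by left; exact: oner_neq0.
    rewrite !mul1r divfK //; split=> //; apply: (mulIf a0).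
    by rewrite mulrAC divfK // mulrC [e * b]mulrC; apply/eqP; rewrite -subr_eq0 det.
  have [b0|b0] := eqVneq b 0; last first.
    exists 1, (f / b), a, b; split; last by left; exact: oner_neq0.
    rewrite !mul1r divfK //; split=> //; rewrite a0 mulr0.
    by move: det; rewrite a0 mul0r sub0r => /eqP; rewrite oppr_eq0 mulf_eq0 (negPf b0) => /eqP.
  exists 0, 1, e, f; rewrite a0 b0 !mul0r !mul1r; split=> //.
  by right; exact: oner_neq0.
have [g1 g1E] := pth_root c1 p0; have [g2 g2E] := pth_root c2 p0.
pose l := d1 * g1 + d2 * g2.
have lE : l ^+ p = d1 ^+ p * c1 + d2 ^+ p * c2.
  by rewrite /l frobD !exprMn g1E g2E.
have cond1 : f ^+ p + a * e ^+ p.-1 = c2 ^+ p.-1 * l ^+ p.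
  have expp (u : k) : u ^+ p = u * u ^+ p.-1 by rewrite -exprS prednK.
  by rewrite lE fE aE eE !exprMn (expp d1) (expp c2); ring.
have cond2 : b ^+ p * e + a ^+ p.+1 = c1 ^+ p * d1 * l ^+ p.
  by rewrite lE bE eE aE !exprMn !exprS; ring.
have p10 : (0 < p.-1)%N by rewrite -ltnS prednK.
have -> : (f ^+ p + a * e ^+ p.-1 == 0) && (b ^+ p * e + a ^+ p.+1 == 0) = (l == 0).
  rewrite cond1 cond2 !mulf_eq0 !expf_eq0 p0 p10 /=.
  have [//|l0] := eqVneq l 0; first by rewrite !orbT.
  rewrite !orbF; apply/negbTE/negP => /andP [/eqP c20 /orP [/eqP c10|/eqP d10]].
    by case: c0 => /eqP.
  move: lE; rewrite c20 d10 mulr0 addr0 expr0n eqn0Ngt p0 mul0r => /eqP.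
  by rewrite expf_eq0 (negPf l0) andbF.
(* The solutions lie on the line spanned by the p-th root of c. *)
have sysE w : frob_sys a b e f w <-> exists2 t, t ^+ p = l * t & w = (g1 * t, g2 * t).
  split.
    case: w => u v [/= e1 e2]; have [t tE] := pth_root (d1 * u + d2 * v) p0.
    have uE : u = g1 * t.
      by apply: frob_inj; rewrite exprMn g1E tE e1 aE bE; ring.
    have vE : v = g2 * t.
      by apply: frob_inj; rewrite exprMn g2E tE e2 eE fE; ring.
    by exists t; rewrite -?uE -?vE // tE {1}uE {1}vE /l; ring.
  case=> t tE ->; split; rewrite /= exprMn tE ?g1E ?g2E ?aE ?bE ?eE ?fE /l; ring.
have g0 : g1 != 0 \/ g2 != 0.
  by case: c0; rewrite -?g1E -?g2E expf_eq0 p0 /=; [left|right].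
have [l0|l0] := eqVneq l 0.
  exists [:: (0, 0)]; split=> // w; rewrite sysE inE; split.
    case=> t /eqP; rewrite l0 mul0r expf_eq0 p0 /= => /eqP -> ->.
    by rewrite !mulr0.
  by move=> /eqP ->; exists 0; rewrite ?mulr0 // expr0n eqn0Ngt p0.
have [s [us ss sP]] := additive_solutions l0.
exists [seq (g1 * t, g2 * t) | t <- s]; split.
- rewrite map_inj_uniq // => t t' [e1 e2].
  by case: g0 => g0; [exact: (mulfI g0 e1)|exact: (mulfI g0 e2)].
- by rewrite size_map.
move=> w; rewrite sysE; split=> [[t /sP ts ->]|/mapP [t ts ->]].
  by apply/mapP; exists t.
by exists t => //; apply/sP.
Qed.

End Count.

(** * The function field and the divisor classes *)

Section FunctionField.
Variables (k : fieldType) (g : quintic k) (two0 : 2 != 0 :> k).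
Local Notation K := (function_field g).
Local Notation G := (quintic_poly g).

Definition involution (f : K) : K :=
  fracK g (Kcoord f 0) - fracK g (Kcoord f 1) * yK g.

Lemma involutionE a b :
  involution (fracK g a + fracK g b * yK g) = fracK g a - fracK g b * yK g.
Proof. by have [e0 e1] := KcoordE g a b; rewrite /involution e0 e1. Qed.

Lemma involution_is_zmod_morphism : zmod_morphism involution.
Proof.
have id1 (F : fieldType) (a b c d y : F) :
    a + b * y - (c + d * y) = a - c + (b - d) * y by ring.
have id2 (F : fieldType) (a b c d y : F) :
    a - c - (b - d) * y = a - b * y - (c - d * y) by ring.
move=> f h; have -> : f - h =
    fracK g (Kcoord f 0 - Kcoord h 0) + fracK g (Kcoord f 1 - Kcoord h 1) * yK g.
  rewrite {1}(Kbasis f) {1}(Kbasis h) 2!(rmorphB (fracK g)).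
  exact: (id1 K _ _ _ _ (yK g)).
rewrite involutionE 2!(rmorphB (fracK g)).
exact: (id2 K _ _ _ _ (yK g)).
Qed.
HB.instance Definition _ :=
  GRing.isZmodMorphism.Build K K involution involution_is_zmod_morphism.

Lemma involution_is_monoid_morphism : monoid_morphism involution.
Proof.
split=> [|f h].
  by have := involutionE 1 0; rewrite !rmorph0 !rmorph1 !mul0r addr0 subr0.
have mulE a b c d := @mulK_aux _ _ (fracK g) a b c d _ _ (yK_sqr g).
rewrite {1}(Kbasis f) {1}(Kbasis h) mulE involutionE /involution.
have subE a b : fracK g a - fracK g b * yK g = fracK g a + fracK g (- b) * yK g.
  by rewrite rmorphN mulNr.
by rewrite !subE mulE mulrNN mulrN mulNr opprD.
Qed.
HB.instance Definition _ :=
  GRing.isMonoidMorphism.Build K K involution involution_is_monoid_morphism.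

Lemma involution_poly A : involution (polyK g A) = polyK g A.
Proof.
by have := involutionE (tofrac A) 0; rewrite !rmorph0 !mul0r addr0 subr0.
Qed.

Lemma involution_y : involution (yK g) = - yK g.
Proof.
by have := involutionE 0 1; rewrite !rmorph0 !rmorph1 !mul1r add0r sub0r.
Qed.

Lemma polyK_horner A : (map_poly (constK g) A).[xK g] = polyK g A.
Proof.
elim/poly_ind: A => [|A a IH]; first by rewrite !rmorph0 hornerC.
rewrite rmorphD rmorphM /= map_polyX map_polyC /= !hornerE IH.
by rewrite rmorphD rmorphM.
Qed.

Lemma function_field_myE : yK g ^+ 2 = (map_poly (constK g) G).[xK g].
Proof. by rewrite polyK_horner yK_sqr. Qed.

Lemma function_field_indep A B :
  (map_poly (constK g) A).[xK g] + (map_poly (constK g) B).[xK g] * yK g = 0 ->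
  A = 0 /\ B = 0.
Proof.
rewrite !polyK_horner => e.
have [ea eb] := KcoordE g (tofrac A) (tofrac B); rewrite [_ + _]e in ea eb.
have [e0 e1] := KcoordE g 0 0; rewrite !rmorph0 mul0r addr0 in e0 e1.
split; apply/eqP; rewrite -tofrac_eq0; apply/eqP.
  exact: etrans (esym ea) e0.
exact: etrans (esym eb) e1.
Qed.

Lemma function_field_gen (f : K) : exists A B C : {poly k}, C != 0 /\
  f * (map_poly (constK g) C).[xK g] =
  (map_poly (constK g) A).[xK g] + (map_poly (constK g) B).[xK g] * yK g.
Proof.
have [[n d] /= d0 nE] := fracP (Kcoord f 0); have [[m e] /= e0 mE] := fracP (Kcoord f 1).
exists (n * e), (m * d), (d * e); split; first by rewrite mulf_neq0.
have d1 : polyK g d != 0 by rewrite fmorph_eq0 tofrac_eq0.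
have e1 : polyK g e != 0 by rewrite fmorph_eq0 tofrac_eq0.
have id (F : fieldType) (N M D E Y : F) : D != 0 -> E != 0 ->
    (N / D + M / E * Y) * (D * E) = N * E + M * D * Y.
  by move=> D0 E0; field; rewrite D0 E0.
rewrite !polyK_horner [in LHS](Kbasis f) nE mE !fmorph_div !rmorphM.
exact: (id K (polyK g n) (polyK g m) _ _ (yK g) d1 e1).
Qed.

Lemma function_field_derivation : derivation (@theta k g).
Proof.
by split=> f h; [rewrite /theta ddxD mulrDr|exact: thetaM].
Qed.

Lemma function_field_theta_const a : theta (constK g a) = 0.
Proof. by rewrite /theta ddx_const mulr0. Qed.

Definition function_field_model : curve_model g K :=
  CurveModel function_field_myE function_field_indep function_field_gen
    function_field_derivation function_field_theta_const (theta_xK g)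
    (fun a => involution_poly a%:P) (involution_poly 'X) involution_y.

End FunctionField.

Section Jacobian.
Variables (k : fieldType) (g : quintic k).
Local Notation quot := (Quotient.quot (@principal0 k g)).

Definition div_class (D : divisor0 g) : jacobian g := (\pi_quot D)%qT.

Lemma div_class_surj (c : jacobian g) : exists D, c = div_class D.
Proof. by exists (repr (c : quot)); rewrite /div_class reprK. Qed.

Lemma div_classMn D n : div_class (D *+ n) = div_class D *+ n.
Proof. exact: (raddfMn (\pi_quot)%qT). Qed.

Lemma div_class_eq D E : div_class D = div_class E <-> principal (val D - val E).
Proof.
have -> : val D - val E = val (D - E) by rewrite raddfB.
split=> [/eqP|pr].
  by rewrite /div_class -Quotient.idealrBE => /asboolP.
by apply/eqP; rewrite /div_class -Quotient.idealrBE; apply/asboolP.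
Qed.

Lemma div_class_eq0 D : div_class D = 0 <-> principal (val D).
Proof.
have <- : div_class 0 = 0 by exact: (raddf0 (\pi_quot)%qT).
by rewrite div_class_eq (_ : val (0 : divisor0 g) = 0) ?subr0 // raddf0.
Qed.

End Jacobian.

(** * Torsion classes and logarithmic forms *)

Section Main.
Variables (k : closedFieldType) (p : nat).
Hypotheses (hp : p \in [pchar k]) (p_gt2 : (2 < p)%N).
Variable g : quintic k.
Hypothesis C_smooth : affine_smooth g.
Variables (gp : {poly k}) (gpE : polyK g gp = iter p.-1 (@theta k g) (xK g)).

Let two0 : 2 != 0 :> k := two_pchar hp p_gt2.
Let M := function_field_model g two0.
Local Notation K := (function_field g).
Local Notation has_divisor := (has_divisor M two0 C_smooth).

Lemma evalkE P u : evalk P u = ev2k (point_chart M two0 C_smooth P) u.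
Proof. by case: P. Qed.

Lemma evalKE P u : evalK P u = ev2K (point_chart M two0 C_smooth P) u.
Proof. by case: P. Qed.

Lemma uniformizerE P : uniformizer P = chart_unif (point_chart M two0 C_smooth P).
Proof. by case: P => [Q|] //; rewrite /chart_unif /= eqxx. Qed.

Lemma has_ord_chart P f n : has_ord P f n <-> has_order (point_chart M two0 C_smooth P) f n.
Proof.
split; last first.
  move=> /has_orderE [u [w [u0 w0 e]]]; exists u, w.
  by rewrite !evalkE !evalKE uniformizerE.
move=> [u [w [u0 w0 e]]]; apply/has_orderE; exists u, w.
by rewrite -!evalkE -!evalKE -uniformizerE.
Qed.

Lemma principalE D : principal D <-> exists2 f : K, f != 0 & has_divisor f D.
Proof.
by split=> -[f f0 fD]; exists f => // P; apply/has_ord_chart; exact: fD.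
Qed.

Let gpE' : px M gp = iter p.-1 (m_theta M) (mx M).
Proof. by rewrite /px /= polyK_horner. Qed.

Let szgp : (size gp <= p.*2)%N.
Proof.
have p_odd : odd p.
  by case: (even_prime (pcharf_prime hp)) => // pE; move: p_gt2; rewrite pE.
have -> : gp = theta_even g p./2.
  apply: (@polyK_inj k g); rewrite gpE -iter_theta_even //; congr iter.
  by rewrite -{1}(odd_double_half p) p_odd.
apply: leq_trans (size_theta_even g p./2) _.
have := odd_double_half p; rewrite p_odd; lia.
Qed.

(** Since df / f = (theta f / f) dx / y, the last condition says that df / f
    is the form with coordinates w. *)
Definition log_form_of (c : jacobian g) (w : k * k) : Prop :=
  exists (D : divisor0 g) (f : K),
    [/\ c = div_class D, f != 0, has_divisor f (val D *+ p) & m_theta M f = form M w * f].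

Let p0 : (0 < p)%N. Proof. exact: ltn_trans p_gt2. Qed.

(** The orders of f are multiples of p, so df / f has no poles. *)
Lemma log_form_total c : c *+ p = 0 -> exists w, log_form_of c w.
Proof.
have [D ->] := div_class_surj c; rewrite -div_classMn.
move/div_class_eq0; rewrite raddfMn => /principalE [f f0 fD].
have cp P : (coeff P (val D *+ p))%:~R = 0 :> k.
  by rewrite coeffMn rmorphMn /= -mulr_natr (pcharf0 hp) mulr0.
have reg P := has_value_logd (fD P) (cp P).
have [||u [v hE]] := @regular_twist _ _ _ M two0 C_smooth (m_theta M f / f).
  by move=> Q; exact: (reg (Some Q)).
  by have := reg None; rewrite /= mulrAC.
exists (u, v), D, f; split=> //.
by rewrite /form /= -hE divfK.
Qed.

Lemma log_form_of_sol c w : log_form_of c w -> frob_sol p gp w.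
Proof.
move=> [D [f [_ f0 _ fE]]].
exact: (log_form_sol hp p_gt2 gpE' szgp f0 fE).
Qed.

(** Two choices of D differ by the divisor of a function e, and then the
    two choices of f differ by e^p and a constant. *)
Lemma log_form_of_fun c w w' : log_form_of c w -> log_form_of c w' -> w = w'.
Proof.
move=> [D [f [-> f0 fD fE]]] [D' [f' [/div_class_eq /principalE [e e0 eD] f'0 f'D f'E]]].
pose h := f / (f' * e ^+ p).
have h0 : has_divisor h 0.
  have := has_divisor_div fD (has_divisorM f'D (has_divisorX p eD)).
  by rewrite mulrnBl [_ + (_ - _)]addrC subrK subrr.
have [|a hE] := @regular_const _ _ _ M two0 C_smooth h.
  by move=> P; have := h0 P; rewrite coeff0 => /has_order_ge0_value; apply.
have fE' : f = m_cst M a * (f' * e ^+ p).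
  by rewrite -hE divfK // mulf_neq0 ?expf_neq0.
apply: (@form_inj _ _ _ M).
exact: (log_deriv_pth_power (theta_deriv M) (pchar_model M hp) f0 (theta_cst M a) fE' fE f'E).
Qed.

(** The quotient of the two functions is killed by theta, so it is e^p for
    some e, and the difference of the two divisors is the divisor of e. *)
Lemma log_form_of_inj c c' w : log_form_of c w -> log_form_of c' w -> c = c'.
Proof.
move=> [D [f [-> f0 fD fE]]] [D' [f' [-> f'0 f'D f'E]]].
have [e eE] := theta_kernel hp p_gt2 (log_deriv_quotient (theta_deriv M) f'0 fE f'E).
have e0 : e != 0.
  apply: contraTneq (_ : f / f' != 0); last by rewrite mulf_neq0 ?invr_eq0.
  by rewrite eE => ->; rewrite expr0n eqn0Ngt p0 eqxx.
apply/div_class_eq/principalE; exists e => // P.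
have [n en] := has_order_exists (point_chart M two0 C_smooth P) e0.
have := has_divisor_div fD f'D P; rewrite eE -mulrnBl coeffMn.
move/(has_order_fun (has_orderX p en))/eqP; rewrite eqrMn2r => /orP [|/eqP <- //].
by rewrite eqn0Ngt p0.
Qed.

Lemma intr_eq0_pchar (n : int) : n%:~R = 0 :> k -> exists m : int, n = m *+ p.
Proof.
case: n => n; rewrite ?NegzE ?rmorphN /= -pmulrn => /eqP; rewrite ?oppr_eq0.
  rewrite -(dvdn_pcharf hp) => /dvdnP [q ->]; exists q%:Z.
  by rewrite PoszM -mulr_natr natz.
rewrite -(dvdn_pcharf hp) => /dvdnP [q ->]; exists (- q%:Z).
by rewrite PoszM mulNrn -mulr_natr natz.
Qed.

(** The form has no poles, so the orders of f are multiples of p, and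
    div f / p has degree zero because div f has. *)
Lemma log_form_of_surj w : frob_sol p gp w -> exists2 c, c *+ p = 0 & log_form_of c w.
Proof.
move=> /(log_form_exists hp p_gt2 gpE' szgp) [f f0 fE].
have [E fdE E0] := has_divisor_exists M two0 C_smooth f0.
have hE : theta f / f = form M w by rewrite -[theta f]/(m_theta M f) fE mulfK.
have dv P : exists m : int, coeff P E = m *+ p.
  apply: intr_eq0_pchar.
  case: P (fdE P) => [Q|] oP.
    apply: (order_of_logd_value (v := w.1 + w.2 * (val Q).1) oP); rewrite /= hE.
    apply: has_valueD (has_valueC _ _) (has_valueM (has_valueC _ _) _).
    exact: (has_valueX (point_chart M two0 C_smooth (Some Q))).
  apply: (order_of_logd_value (v := w.1 * 0 + w.2) oP); rewrite /= mulrAC hE.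
  rewrite mulrDl mulfK ?(x_neq0 M) //.
  apply: has_valueD (has_valueM (has_valueC _ _) _) (has_valueC _ _).
  exact: (value_inf_xV M two0 C_smooth).
have [m mE] := choice dv.
pose D : divisor g := \sum_(P <- dom E) << m P *g P >>.
have DE : D *+ p = E.
  rewrite -[RHS]freeg_sumE /D -sumrMnl; apply: eq_bigr => P _.
  by rewrite freeg_muln mE.
have D0 : D \in @degree_zero k g.
  have := degMn p D; rewrite DE E0 => /esym/eqP; rewrite mulrn_eq0 => /orP [|//].
  by rewrite eqn0Ngt p0.
pose D1 := Divisor0 D0.
have fD : has_divisor f (val D1 *+ p) by rewrite /= DE.
exists (div_class D1); last by exists D1, f.
rewrite -div_classMn; apply/div_class_eq0/principalE; exists f => //.
by rewrite raddfMn.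
Qed.

Lemma p_rank_of_solutions r : solutions (frob_sol p gp) (p ^ r) -> has_p_rank g p r.
Proof.
move=> [s [us ss sP]]; rewrite /has_p_rank -ss.
have ex (c : jacobian g) : exists w, c *+ p = 0 -> log_form_of c w.
  have [c0|c0] := pselect (c *+ p = 0); last by exists (0, 0).
  by have [w cw] := log_form_total c0; exists w.
have [F FE] := choice ex.
apply: (@card_eq_trans _ _ _ _ (F @` torsion p)%classic); last first.
  apply: (card_uniq_seq us) => w; rewrite -sP; split.
    by case=> c /FE cw <-; exact: log_form_of_sol cw.
  case/log_form_of_surj => c c0 cw; exists c => //.
  exact: log_form_of_fun (FE c c0) cw.
apply/card_esym/inj_card_eq => c c' /set_mem c0 /set_mem c0' e.
by apply: (log_form_of_inj (FE c c0)); rewrite e; exact: FE.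
Qed.

End Main.

Theorem proposition4p3 (k : closedFieldType) (p : nat)
    (hp : p \in [pchar k]) (p_gt2 : (2 < p)%N)
    (a1 a2 a3 a4 a5 : k) (g := Quintic a1 a2 a3 a4 a5)
    (C_smooth : affine_smooth g)
    (gp : {poly k}) (gpE : polyK g gp = iter p.-1 (@theta k g) (xK g))
    (h1 := gp`_0) (h2 := gp`_1) (h3 := gp`_p) (h4 := gp`_p.+1) :
  [/\ h1 * h4 - h2 * h3 != 0 -> has_p_rank g p 2,
      h1 * h4 - h2 * h3 = 0 ->
        h3 ^+ p - h2 * h4 ^+ p.-1 != 0 \/ h1 ^+ p * h4 - h2 ^+ p.+1 != 0 ->
        has_p_rank g p 1
    & h1 * h4 - h2 * h3 = 0 -> h3 ^+ p - h2 * h4 ^+ p.-1 = 0 ->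
        h1 ^+ p * h4 - h2 ^+ p.+1 = 0 -> has_p_rank g p 0].
Proof.
have rankE n r : solutions (frob_sys p h2 (- h1) h4 (- h3)) n -> n = (p ^ r)%N ->
    has_p_rank g p r.
  move=> [s [us ss sP]] nE; apply: (p_rank_of_solutions hp p_gt2 C_smooth gpE).
  exists s; split=> //; first by rewrite ss.
  by move=> w; rewrite -sP /frob_sol /frob_sys !mulNr.
have detE : h2 * - h3 - - h1 * h4 = h1 * h4 - h2 * h3 by ring.
have frobN (u : k) : (- u) ^+ p = - u ^+ p.
  by rewrite -!(pFrobenius_autE hp) rmorphN.
have cond1 : (- h3) ^+ p + h2 * h4 ^+ p.-1 = - (h3 ^+ p - h2 * h4 ^+ p.-1).
  by rewrite frobN; ring.
have cond2 : (- h1) ^+ p * h4 + h2 ^+ p.+1 = - (h1 ^+ p * h4 - h2 ^+ p.+1).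
  by rewrite frobN; ring.
split.
- by rewrite -detE => det; exact: rankE (frob_sys_regular hp det) (erefl _).
- rewrite -detE => /(frob_sys_singular hp) + ne; rewrite cond1 cond2 !oppr_eq0.
  rewrite (_ : _ && _ = false); first by move/rankE; apply.
  by case: ne => /negPf ->; rewrite ?andbF.
rewrite -detE => /(frob_sys_singular hp) + e1 e2.
by rewrite cond1 cond2 e1 e2 oppr0 eqxx /= => /rankE; apply.
Qed.
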